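(* Let $N=2n$ and let $D_N$ be the double chain on $N$ points. Then the number of non-crossing forests on $D_N$ is $\Omega(13.40^N)$.
   Context: All point sets are in general position. A non-crossing forest on a point set $S$ is an acyclic graph with vertex set $S$ whose edges are straight-line segments between points of $S$, no two of which intersect except at common endpoints (isolated vertices allowed). The double chain on $N=2n$ points consists of two sets of $n$ points each, an upper chain forming a convex chain and a lower chain forming a concave chain, such that every straight line through two points of the upper chain leaves all points of the lower chain on the same side, and vice versa. *)

(* Defs.v *)
From HB Require Import structures.
From mathcomp Require Import all_boot all_order all_algebra.
From mathcomp Require Import boolp reals.

Set Implicit Arguments.
Unset Strict Implicit.
Unset Printing Implicit Defensive.

Import Order.TTheory GRing.Theory Num.Theory.
Local Open Scope ring_scope.

Section Plane.
Variable R : realType.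
Implicit Types a b c q : R * R.

(* Twice the signed area of the triangle abc.  When a.1 < b.1, it is positive
   (negative) iff c lies strictly above (below) the line through a and b. *)
Definition orient a b c : R :=
  (b.1 - a.1) * (c.2 - a.2) - (b.2 - a.2) * (c.1 - a.1).

Definition in_segment a b q : Prop :=
  exists t : R, [/\ 0 <= t <= 1,
    q.1 = (1 - t) * a.1 + t * b.1 & q.2 = (1 - t) * a.2 + t * b.2].

Section PointSet.
Variables (T : finType) (p : T -> R * R).

Definition general_position : Prop :=
  injective p /\
  forall x y z : T, x != y -> y != z -> x != z -> orient (p x) (p y) (p z) != 0.

(* A graph with vertex set T is given by its set of edges, an edge being the
   set of its two distinct endpoints. *)
Definition is_graph (E : {set {set T}}) : Prop :=
  forall e, e \in E -> #|e| = 2%N.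

Definition adj (E : {set {set T}}) : rel T := fun x y => [set x; y] \in E.

(* ucycle imposes no minimal length: a list [:: x; y] traverses the single edge
   xy back and forth, so cycles of the graph are those of length at least 3. *)
Definition acyclic (E : {set {set T}}) : Prop :=
  forall s : seq T, ucycle (adj E) s -> (size s <= 2)%N.

Definition noncrossing (E : {set {set T}}) : Prop :=
  forall x y z w : T,
    [set x; y] \in E -> [set z; w] \in E -> [set x; y] != [set z; w] ->
    forall q, in_segment (p x) (p y) q -> in_segment (p z) (p w) q ->
    exists2 v, v \in [set x; y] :&: [set z; w] & q = p v.

Definition noncrossing_forest (E : {set {set T}}) : Prop :=
  [/\ is_graph E, acyclic E & noncrossing E].

Definition num_noncrossing_forests : nat :=
  #|[set E : {set {set T}} | `[< noncrossing_forest E >]]|.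

End PointSet.

Section DoubleChain.
Variable n : nat.
Implicit Types U L : 'I_n -> R * R.

Definition x_increasing (P : 'I_n -> R * R) : Prop :=
  forall i j : 'I_n, (i < j)%N -> (P i).1 < (P j).1.

Definition convex_chain (P : 'I_n -> R * R) : Prop :=
  x_increasing P /\ forall i j k : 'I_n, (i < j)%N -> (j < k)%N ->
    0 < orient (P i) (P j) (P k).

Definition concave_chain (P : 'I_n -> R * R) : Prop :=
  x_increasing P /\ forall i j k : 'I_n, (i < j)%N -> (j < k)%N ->
    orient (P i) (P j) (P k) < 0.

Definition chains_points U L (v : 'I_n + 'I_n) : R * R :=
  match v with inl i => U i | inr j => L j end.

(* Of the two possible sides, the lower chain lies below the lines spanned by
   the upper chain, and the upper chain above those spanned by the lower chain:
   with the opposite sides the 2n points would be in convex position. *)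
Definition double_chain U L : Prop :=
  [/\ general_position (chains_points U L),
      convex_chain U,
      concave_chain L,
      forall i j k : 'I_n, (i < j)%N -> orient (U i) (U j) (L k) < 0
    & forall i j k : 'I_n, (i < j)%N -> 0 < orient (L i) (L j) (U k)].

End DoubleChain.
End Plane.

(* Main.v *)
Require Import Defs.
From HB Require Import structures.
From mathcomp Require Import all_boot all_order all_algebra.
From mathcomp Require Import boolp classical_sets reals topology normedtype sequences.
From mathcomp Require Import zify ring lra.

(* Keep on each chain a non-crossing forest in which every component has at most one
   marked vertex, and join the marked vertices of the two chains by a monotone
   ("staircase") bipartite graph covering all of them.  Edges inside a chain and edges
   between the chains never cross, and the staircase is a forest, so the union is one.
   The staircases on a+1 and b+1 marks number sum_j C(a,j) C(b,j) 2^j; hence, by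
   Cauchy-Schwarz and since (7/5)^2 <= 2, the number of drawings on two chains of n points
   is, up to a factor polynomial in n, at least the square of the sum over forests of
   (12/5)^(number of marks).  The generating function of these weighted forests satisfies
   a polynomial system without solution at 1/13.45, so it diverges there, and some m
   columns carry at least 13.40^(2m) drawings; juxtaposing blocks gives every n. *)

Set Implicit Arguments.
Unset Strict Implicit.
Unset Printing Implicit Defensive.

(** * Codes of forests *)

(** The weight [12/5 = 1 + 7/5] is a rational value just below [1 + sqrt 2]: writing [2^j] as
    [sqrt 2^j * sqrt 2^j] splits the number of staircases into one factor per chain, and the
    binomial theorem sums each factor to a power of [1 + sqrt 2]. Divergence is reached by
    contradiction. Partial sums over codes of bounded depth increase, so a bound at one rational
    point would yield a real solution of the polynomial system. The gap between 13.45 and 13.40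
    absorbs all polynomial factors, and a single large coefficient suffices because blocks side by
    side multiply their counts. Acyclicity is carried throughout as the existence, for every edge,
    of a vertex set that only this edge leaves. This form passes easily through pendant edges,
    gluing at marks and disjoint unions; cycles appear only at the very end. Codes turn the counting
    into structural recursion; the price is to show that a code can be recovered from its edges and
    marks. *)

(* A code of size k is laid out on an interval of k consecutive vertices.  For a wing,
   i.e. the part of a tree hanging from an attachment vertex outside the interval,
   [Node m l g r t] has from left to right: the left wing [l] of a child v of the attachment
   vertex, v itself (marked iff [m]), a forest [g] not linked to the rest, the right wing
   [r] of v, and the remaining children [t].  A forest has no attachment vertex: v is
   then the first vertex of the interval, and [l] and [t] are empty. *)
Inductive code := Nil | Node (m : bool) (l g r t : code).

Definition is_nil c := if c is Nil then true else false.

Fixpoint sz c := if c is Node _ l g r t then (sz l + sz g + sz r + sz t).+1 else 0.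

(* [b] tells whether there is an attachment vertex [a]; [s] is the first vertex. *)
Fixpoint edges (b : bool) (a s : nat) (c : code) : seq (nat * nat) :=
  if c is Node _ l g r t then
    let v := s + sz l in
    (if b then [:: (a, v)] else [::]) ++
    edges true v s l ++ edges false 0 v.+1 g ++ edges true v (v.+1 + sz g) r ++
    edges b a (v.+1 + sz g + sz r) t
  else [::].

Fixpoint marks (s : nat) (c : code) : seq nat :=
  if c is Node m l g r t then
    let v := s + sz l in
    marks s l ++ (if m then [:: v] else [::]) ++ marks v.+1 g ++
    marks (v.+1 + sz g) r ++ marks (v.+1 + sz g + sz r) t
  else [::].

(* The marks outside all gap forests, hence in a single component. *)
Fixpoint skel_marks (s : nat) (c : code) : seq nat :=
  if c is Node m l g r t then
    let v := s + sz l in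
    skel_marks s l ++ (if m then [:: v] else [::]) ++
    skel_marks (v.+1 + sz g) r ++ skel_marks (v.+1 + sz g + sz r) t
  else [::].

Fixpoint nskel c :=
  if c is Node m l g r t then m + nskel l + nskel r + nskel t else 0.

Fixpoint wf (b : bool) (c : code) : bool :=
  if c is Node m l g r t then
    [&& wf true l, wf false g, wf true r, wf true t &
        b || [&& is_nil l, is_nil t & m + nskel r <= 1]]
  else true.

Lemma size_skel_marks s c : size (skel_marks s c) = nskel c.
Proof.
elim: c s => //= m l IHl g _ r IHr t IHt s.
rewrite !size_cat IHl IHr IHt; case: m => /=; lia.
Qed.

(** * Edges of a code: ranges, crossings and bridges *)

Lemma edges_range b a s c x y : (x, y) \in edges b a s c ->
  s <= y < s + sz c /\ ((b /\ x = a) \/ s <= x < s + sz c).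
Proof.
elim: c b a s => //= m l IHl g IHg r IHr t IHt b a s.
rewrite !mem_cat => /or4P[|/IHl|/IHg|/orP[/IHr|/IHt]]; try lia.
by case: b => //; rewrite inE => /eqP[-> ->]; lia.
Qed.

(** Each source of an edge comes with ranges for both endpoints, so that conflicts of position
    reduce to arithmetic. *)
Variant edges_spec (b : bool) a s m l g r t x y : Prop :=
  | EdgesAtt of b & x = a & y = s + sz l
  | EdgesL of (x, y) \in edges true (s + sz l) s l
      & s <= y < s + sz l & s <= x <= s + sz l
  | EdgesG of (x, y) \in edges false 0 (s + sz l).+1 g
      & s + sz l < y < (s + sz l).+1 + sz g & s + sz l < x < (s + sz l).+1 + sz g
  | EdgesR of (x, y) \in edges true (s + sz l) ((s + sz l).+1 + sz g) r
      & (s + sz l).+1 + sz g <= y < (s + sz l).+1 + sz g + sz r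
      & (x = s + sz l \/ (s + sz l).+1 + sz g <= x < (s + sz l).+1 + sz g + sz r)
  | EdgesT of (x, y) \in edges b a ((s + sz l).+1 + sz g + sz r) t
      & (s + sz l).+1 + sz g + sz r <= y < s + sz (Node m l g r t)
      & (b /\ x = a \/ (s + sz l).+1 + sz g + sz r <= x < s + sz (Node m l g r t)).

Lemma edgesP b a s m l g r t x y :
  (x, y) \in edges b a s (Node m l g r t) -> edges_spec b a s m l g r t x y.
Proof.
rewrite /= !mem_cat => /or4P[|H|H|/orP[H|H]].
- by case: b => //; rewrite inE => /eqP[-> ->]; constructor.
- by have := edges_range H => ?; constructor 2; move=> //; lia.
- by have := edges_range H => ?; constructor 3; move=> //; lia.
- by have := edges_range H => ?; constructor 4; move=> //; lia.
- by have := edges_range H => ?; constructor 5; rewrite //=; lia.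
Qed.

Lemma edges_node_att (b : bool) a s m l g r t :
  b -> (a, s + sz l) \in edges b a s (Node m l g r t).
Proof. by move=> hb; rewrite /= hb inE eqxx. Qed.

Lemma edges_nodeL b a s m l g r t x y :
  (x, y) \in edges true (s + sz l) s l -> (x, y) \in edges b a s (Node m l g r t).
Proof. by move=> H; rewrite /= !mem_cat H ?orbT. Qed.

Lemma edges_nodeG b a s m l g r t x y :
  (x, y) \in edges false 0 (s + sz l).+1 g -> (x, y) \in edges b a s (Node m l g r t).
Proof. by move=> H; rewrite /= !mem_cat H ?orbT. Qed.

Lemma edges_nodeR b a s m l g r t x y :
  (x, y) \in edges true (s + sz l) ((s + sz l).+1 + sz g) r ->
  (x, y) \in edges b a s (Node m l g r t).
Proof. by move=> H; rewrite /= !mem_cat H ?orbT. Qed.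

Lemma edges_nodeT b a s m l g r t x y :
  (x, y) \in edges b a ((s + sz l).+1 + sz g + sz r) t ->
  (x, y) \in edges b a s (Node m l g r t).
Proof. by move=> H; rewrite /= !mem_cat H ?orbT. Qed.

Definition outside (b : bool) a s c := b -> (a < s) || (s + sz c <= a).

Lemma edges_neq b a s c x y : outside b a s c -> (x, y) \in edges b a s c -> x != y.
Proof.
rewrite /outside; elim: c b a s => // m l IHl g IHg r IHr t IHt b a s Ha.
case/edgesP.
- by move=> hb -> ->; have /= := Ha hb; lia.
- by move/IHl => H _ _; apply: H; lia.
- by move/IHg => H _ _; apply: H; lia.
- by move/IHr => H _ _; apply: H; lia.
- by move/IHt => H _ _; apply: H => /= hb; have := Ha hb => /=; lia.
Qed.

(** One of the two interleavings; the other arises by exchanging the edges. *)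
Definition crossing x y x' y' :=
  minn x y < minn x' y' < maxn x y /\ maxn x y < maxn x' y'.

(** The parts of a node occupy consecutive intervals, so edges of different parts are disjoint,
    nested or share an endpoint; edges of the same part are left to induction. *)
Lemma edges_noncrossing b a s c x y x' y' : outside b a s c ->
  (x, y) \in edges b a s c -> (x', y') \in edges b a s c -> ~ crossing x y x' y'.
Proof.
rewrite /outside /crossing; elim: c b a s => // m l IHl g IHg r IHr t IHt b a s Ha.
have {Ha} Hb : b -> a < s \/ s + (sz l + sz g + sz r + sz t).+1 <= a.
  by move/Ha => /= /orP.
move=> /edgesP E1 /edgesP E2.
case: E1 => [hb ? ?|H /= H1 H2|H /= H1 H2|H /= H1 H2|H /= H1 H2];
case: E2 => [hb' ? ?|H' /= H1' H2'|H' /= H1' H2'|H' /= H1' H2'|H' /= H1' H2'];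
  try (clear -Hb H1 H2 H1' H2'; case: b Hb H2 H2' => Hb *; try have := Hb isT; lia);
  try lia.
- by apply: (IHl _ _ _ _ H H'); lia.
- by apply: (IHg _ _ _ _ H H').
- by apply: (IHr _ _ _ _ H H'); lia.
- by apply: (IHt _ _ _ _ H H') => hb; have := Hb hb; lia.
Qed.

Definition within lo hi x := lo <= x < hi.

Section Node.
Variables (b : bool) (a s : nat) (m : bool) (l g r t : code).
Hypothesis out : outside b a s (Node m l g r t).
Let v := s + sz l.

Lemma outsideP : b -> a < s \/ s + (sz l + sz g + sz r + sz t).+1 <= a.
Proof. by move/out => /= /orP. Qed.

Lemma outsideL : outside true v s l. Proof. by rewrite /outside /v; lia. Qed.
Lemma outsideG : outside false 0 v.+1 g. Proof. by []. Qed.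
Lemma outsideR : outside true v (v.+1 + sz g) r. Proof. by rewrite /outside /v; lia. Qed.
Lemma outsideT : outside b a (v.+1 + sz g + sz r) t.
Proof. by move=> hb; have := outsideP hb; rewrite /v; lia. Qed.

Variables (lo hi x y : nat).
Hypothesis xy : (x, y) \in edges b a s (Node m l g r t).
Hypothesis cut : within lo hi x != within lo hi y.

Lemma cutL : s <= lo -> hi <= v -> (x, y) \in edges true v s l.
Proof.
have Hb := outsideP; move: cut; rewrite /within /v => C lo1 hi1.
by case/edgesP: xy => //= *; lia.
Qed.

Lemma cutG : v < lo -> hi <= v.+1 + sz g -> (x, y) \in edges false 0 v.+1 g.
Proof.
have Hb := outsideP; move: cut; rewrite /within /v => C lo1 hi1.
by case/edgesP: xy => //= *; lia.
Qed.

Lemma cutR : v.+1 + sz g <= lo -> hi <= v.+1 + sz g + sz r ->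
  (x, y) \in edges true v (v.+1 + sz g) r.
Proof.
have Hb := outsideP; move: cut; rewrite /within /v => C lo1 hi1.
by case/edgesP: xy => //= *; lia.
Qed.

Lemma cutT : v.+1 + sz g + sz r <= lo -> hi <= s + sz (Node m l g r t) ->
  (x, y) \in edges b a (v.+1 + sz g + sz r) t.
Proof.
have Hb := outsideP; move: cut; rewrite /within /v /= => C lo1 hi1.
by case/edgesP: xy => //= *; lia.
Qed.

Lemma cutV : lo = s -> hi = v.+1 + sz g + sz r -> [/\ b, x = a & y = v].
Proof.
have Hb := outsideP; move: cut; rewrite /within /v /= => C lo1 hi1.
by case/edgesP: xy => //= *; lia.
Qed.

End Node.

(** The edge from the attachment vertex to its child [v] is the only one leaving the interval formed
    by [v], its wings and its gap forest. Any other edge keeps the cut found in its own part, since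
    an edge leaving an interval inside a part belongs to that part. *)
Lemma edges_cut b a s c x y : outside b a s c -> (x, y) \in edges b a s c ->
  exists lo hi, [/\ s <= lo, hi <= s + sz c, within lo hi x != within lo hi y &
    forall x' y', (x', y') \in edges b a s c ->
      within lo hi x' != within lo hi y' -> (x', y') = (x, y)].
Proof.
elim: c b a s => // m l IHl g IHg r IHr t IHt b a s out.
case/edgesP => [hb -> ->|H _ _|H _ _|H _ _|H _ _].
- exists s, ((s + sz l).+1 + sz g + sz r); split; rewrite //= /within; try lia.
    by have := outsideP out hb; lia.
  by move=> x' y' xy' C; have [_ -> ->] := cutV out xy' C erefl erefl.
- have [lo [hi [lo1 hi1 C U]]] := IHl _ _ _ (@outsideL s l) H.
  exists lo, hi; split=> //; first by rewrite /=; lia.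
  by move=> x' y' xy' C'; apply: U => //; apply: (cutL out xy' C'); lia.
- have [lo [hi [lo1 hi1 C U]]] := IHg _ _ _ (@outsideG _ _ _) H.
  exists lo, hi; split=> //; try by rewrite /=; lia.
  by move=> x' y' xy' C'; apply: U => //; apply: (cutG out xy' C'); lia.
- have [lo [hi [lo1 hi1 C U]]] := IHr _ _ _ (@outsideR _ _ _ _) H.
  exists lo, hi; split=> //; try by rewrite /=; lia.
  by move=> x' y' xy' C'; apply: U => //; apply: (cutR out xy' C'); lia.
- have [lo [hi [lo1 hi1 C U]]] := IHt _ _ _ (outsideT out) H.
  exists lo, hi; split=> //; try by rewrite /=; lia.
  by move=> x' y' xy' C'; apply: U => //; apply: (cutT out xy' C') => /=; lia.
Qed.

(** * Marks: at most one in each component *)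

Lemma marks_range s c x : x \in marks s c -> s <= x < s + sz c.
Proof.
elim: c s => //= m l IHl g IHg r IHr t IHt s.
rewrite !mem_cat => /or4P[/IHl||/IHg|/orP[/IHr|/IHt]]; try lia.
by case: m => //; rewrite inE; lia.
Qed.

Lemma wf_false_nskel c : wf false c -> nskel c <= 1.
Proof.
case: c => //= m l g r t /and5P[_ _ _ _].
by case: l => //; case: t => //=; lia.
Qed.

(** No edge leaves such an interval, so it is a union of components; this expresses disconnection
    without paths. *)
Definition closed_itv b a s c lo hi := [/\ s <= lo, hi <= s + sz c &
  forall x y, (x, y) \in edges b a s c -> within lo hi x = within lo hi y].

Section ClosedNode.
Variables (b : bool) (a s : nat) (m : bool) (l g r t : code).
Hypothesis out : outside b a s (Node m l g r t).
Let v := s + sz l.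
Let c := Node m l g r t.

Lemma closedL lo hi : closed_itv true v s l lo hi -> closed_itv b a s c lo hi.
Proof.
move=> [lo1 hi1 C]; split=> //; first by rewrite /=; lia.
move=> x y xy; apply/eqP/negPn/negP => D; move: (D).
by rewrite (C x y) ?eqxx //; apply: (cutL out xy D).
Qed.

Lemma closedG lo hi : closed_itv false 0 v.+1 g lo hi -> closed_itv b a s c lo hi.
Proof.
rewrite /v => -[lo1 hi1 C]; split=> //; try by rewrite /=; lia.
move=> x y xy; apply/eqP/negPn/negP => D; move: (D).
by rewrite (C x y) ?eqxx //; apply: (cutG out xy D).
Qed.

Lemma closedR lo hi : closed_itv true v (v.+1 + sz g) r lo hi -> closed_itv b a s c lo hi.
Proof.
rewrite /v => -[lo1 hi1 C]; split=> //; try by rewrite /=; lia.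
move=> x y xy; apply/eqP/negPn/negP => D; move: (D).
by rewrite (C x y) ?eqxx //; apply: (cutR out xy D).
Qed.

Lemma closedT lo hi : closed_itv b a (v.+1 + sz g + sz r) t lo hi -> closed_itv b a s c lo hi.
Proof.
rewrite /v => -[lo1 hi1 C]; split=> //; try by rewrite /=; lia.
move=> x y xy; apply/eqP/negPn/negP => D; move: (D).
by rewrite (C x y) ?eqxx //; apply: (cutT out xy D) => /=; lia.
Qed.

Lemma closed_gap : closed_itv b a s c v.+1 (v.+1 + sz g).
Proof.
apply: closedG; split=> // x y /edges_range; rewrite /within; lia.
Qed.

End ClosedNode.

(** A mark off the skeleton lies in some gap forest, whose interval is closed. *)
Lemma mark_closed b a s c x : outside b a s c -> x \in marks s c ->
  x \in skel_marks s c \/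
  exists lo hi, closed_itv b a s c lo hi /\ within lo hi x.
Proof.
elim: c b a s => // m l IHl g IHg r IHr t IHt b a s out.
rewrite /= !mem_cat => /or4P[H|->|H|/orP[H|H]].
- have [->|[lo [hi [C W]]]] := IHl _ _ _ (@outsideL s l) H; first by left.
  by right; exists lo, hi; split=> //; apply: closedL C.
- by rewrite orbT; left.
- right; exists (s + sz l).+1, ((s + sz l).+1 + sz g).
  by split; [exact: closed_gap | exact: marks_range H].
- have [->|[lo [hi [C W]]]] := IHr _ _ _ (@outsideR _ _ _ _) H.
    by rewrite !orbT; left.
  by right; exists lo, hi; split=> //; apply: closedR C.
- have [->|[lo [hi [C W]]]] := IHt _ _ _ (outsideT out) H.
    by rewrite !orbT; left.
  by right; exists lo, hi; split=> //; apply: closedT C.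
Qed.

Variant marks_spec s m l g r t x : Prop :=
  | MarksL of x \in marks s l & s <= x < s + sz l
  | MarksV of m & x = s + sz l
  | MarksG of x \in marks (s + sz l).+1 g & s + sz l < x < (s + sz l).+1 + sz g
  | MarksR of x \in marks ((s + sz l).+1 + sz g) r
      & (s + sz l).+1 + sz g <= x < (s + sz l).+1 + sz g + sz r
  | MarksT of x \in marks ((s + sz l).+1 + sz g + sz r) t
      & (s + sz l).+1 + sz g + sz r <= x < s + (sz l + sz g + sz r + sz t).+1.

Lemma marksP s m l g r t x :
  x \in marks s (Node m l g r t) -> marks_spec s m l g r t x.
Proof.
rewrite /= !mem_cat => /or4P[H|H|H|/orP[H|H]].
- by have := marks_range H; constructor 1.
- by move: H; case: m => //; rewrite inE => /eqP ->; constructor.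
- by have := marks_range H; constructor 3.
- by have := marks_range H; constructor 4.
- by have := marks_range H => ?; constructor 5 => //; lia.
Qed.

Section RestrictMarks.
Variables (s : nat) (m : bool) (l g r t : code).
Let c := Node m l g r t.
Let v := s + sz l.

Lemma marks_restrictL x : (x \in marks s l) = (x \in marks s c) && (s <= x < v).
Proof.
apply/idP/andP => [xl|[/marksP]]; last by rewrite /v; case=> [? ?|? ?|? ?|? ?|? ?] //; lia.
by split; [rewrite /= mem_cat xl | exact: marks_range].
Qed.

Lemma marks_restrictV : m = (v \in marks s c).
Proof.
apply/idP/idP => [mT|/marksP]; last by rewrite /v; case=> [? ?|? ?|? ?|? ?|? ?] //; lia.
by rewrite /= mT !mem_cat inE eqxx orbT.
Qed.

Lemma marks_restrictG x :
  (x \in marks v.+1 g) = (x \in marks s c) && (v.+1 <= x < v.+1 + sz g).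
Proof.
apply/idP/andP => [xg|[/marksP]]; last by rewrite /v; case=> [? ?|? ?|? ?|? ?|? ?] //; lia.
by split; [rewrite /= !mem_cat xg !orbT | exact: marks_range].
Qed.

Lemma marks_restrictR x : (x \in marks (v.+1 + sz g) r) =
  (x \in marks s c) && (v.+1 + sz g <= x < v.+1 + sz g + sz r).
Proof.
apply/idP/andP => [xr|[/marksP]]; last by rewrite /v; case=> [? ?|? ?|? ?|? ?|? ?] //; lia.
by split; [rewrite /= !mem_cat xr !orbT | exact: marks_range].
Qed.

Lemma marks_restrictT x : (x \in marks (v.+1 + sz g + sz r) t) =
  (x \in marks s c) && (v.+1 + sz g + sz r <= x < v.+1 + sz g + sz r + sz t).
Proof.
apply/idP/andP => [xt|[/marksP]]; last by rewrite /v; case=> [? ?|? ?|? ?|? ?|? ?] //; lia.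
by split; [rewrite /= !mem_cat xt !orbT | exact: marks_range].
Qed.

End RestrictMarks.

Definition separated b a s c x y :=
  exists lo hi, closed_itv b a s c lo hi /\ within lo hi x != within lo hi y.

(** Two skeleton marks may be connected; every other pair must be told apart by a closed
    interval. *)
Definition separable c := forall b a s x y, outside b a s c -> wf b c ->
  x \in marks s c -> y \in marks s c -> x != y ->
  x \in skel_marks s c /\ y \in skel_marks s c \/ separated b a s c x y.

(** The interval from [lo] to [hi] is the part of the node containing [z]. Pairs within one part
    follow by induction. For pairs in different parts, a mark off the skeleton has a closed interval
    inside its own part, which misses the other mark. *)
Lemma marks_part b a s m l g r t z (c := Node m l g r t) :
  outside b a s c -> wf b c ->
  separable l -> separable g -> separable r -> separable t ->
  z \in marks s c ->
  exists lo hi, [/\ within lo hi z,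
    z \in skel_marks s c \/
      exists lo' hi', [/\ closed_itv b a s c lo' hi', within lo' hi' z, lo <= lo' & hi' <= hi] &
    forall w, w \in marks s c -> within lo hi w -> z != w ->
      z \in skel_marks s c /\ w \in skel_marks s c \/ separated b a s c z w].
Proof.
move=> out wfc IHl IHg IHr IHt.
have [wfl wfg wfr wft wfb] : [/\ wf true l, wf false g, wf true r, wf true t &
    b || [&& is_nil l, is_nil t & m + nskel r <= 1]].
  by move: wfc => /= /and5P[].
have wft' : wf b t by move: wfb wft; case: (b) => //= /and3P[_]; case: (t).
case/marksP => [H R|H ->|H R|H R|H R].
- exists s, (s + sz l); split=> //.
    have [S|[lo [hi [[lo1 hi1 C] W]]]] := mark_closed (@outsideL s l) H.
      by left; rewrite /= mem_cat S.
    by right; exists lo, hi; split=> //; apply: closedL.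
  move=> w wc wI zw.
  have Hw : w \in marks s l by rewrite (marks_restrictL s m l g r t) wc.
  have [[S1 S2]|[lo [hi [C D]]]] := IHl _ _ _ _ _ (@outsideL s l) wfl H Hw zw.
    by left; rewrite /= !mem_cat S1 S2.
  by right; exists lo, hi; split=> //; apply: closedL.
- exists (s + sz l), (s + sz l).+1; split; first by rewrite /within leqnn ltnSn.
    by left; rewrite /= H !mem_cat inE eqxx orbT.
  move=> w _; rewrite /within ltnS -eqn_leq => /eqP ->; by rewrite eqxx.
- exists (s + sz l).+1, ((s + sz l).+1 + sz g); split=> //.
    right; exists (s + sz l).+1, ((s + sz l).+1 + sz g); split=> //.
    exact: closed_gap.
  move=> w wc wI zw.
  have Hw : w \in marks (s + sz l).+1 g by rewrite (marks_restrictG s m l g r t) wc.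
  have [[S1 S2]|[lo [hi [C D]]]] := IHg _ _ _ _ _ (@outsideG _ _ _) wfg H Hw zw.
    (* A gap forest has at most one skeleton mark, so two distinct marks cannot both be in its
       skeleton. *)
    have := wf_false_nskel wfg; rewrite -(size_skel_marks (s + sz l).+1).
    case: skel_marks S1 S2 => [|u [|//]] //; rewrite !inE => /eqP E1 /eqP E2.
    by rewrite E1 E2 eqxx in zw.
  by right; exists lo, hi; split=> //; apply: closedG.
- exists ((s + sz l).+1 + sz g), ((s + sz l).+1 + sz g + sz r); split=> //.
    have [S|[lo [hi [[lo1 hi1 C] W]]]] := mark_closed (@outsideR _ _ _ _) H.
      by left; rewrite /= !mem_cat S !orbT.
    by right; exists lo, hi; split=> //; apply: closedR.
  move=> w wc wI zw.
  have Hw : w \in marks ((s + sz l).+1 + sz g) r by rewrite (marks_restrictR s m l g r t) wc.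
  have [[S1 S2]|[lo [hi [C D]]]] := IHr _ _ _ _ _ (@outsideR _ _ _ _) wfr H Hw zw.
    by left; rewrite /= !mem_cat S1 S2 !orbT.
  by right; exists lo, hi; split=> //; apply: closedR.
- exists ((s + sz l).+1 + sz g + sz r), (s + sz c); split=> //.
    have [S|[lo [hi [[lo1 hi1 C] W]]]] := mark_closed (outsideT out) H.
      by left; rewrite /= !mem_cat S !orbT.
    right; exists lo, hi; split=> //; first exact: closedT.
    by rewrite /c /=; clear -hi1; lia.
  move=> w wc wI zw.
  have Hw : w \in marks ((s + sz l).+1 + sz g + sz r) t.
    rewrite (marks_restrictT s m l g r t) wc.
    by move: wI; rewrite /within /c /=; clear; lia.
  have [[S1 S2]|[lo [hi [C D]]]] := IHt _ _ _ _ _ (outsideT out) wft' H Hw zw.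
    by left; rewrite /= !mem_cat S1 S2 !orbT.
  by right; exists lo, hi; split=> //; apply: closedT.
Qed.

Lemma marks_separated c : separable c.
Proof.
elim: c => // m l IHl g IHg r IHr t IHt b a s x y out wfc xc yc xy.
have part z (zc : z \in marks s (Node m l g r t)) :=
  marks_part out wfc IHl IHg IHr IHt zc.
have [lo [hi [xI Hx sameX]]] := part x xc.
have [|yI] := boolP (within lo hi y); first by move=> yI; apply: sameX.
have [lo' [hi' [yI' Hy sameY]]] := part y yc.
have [|xI'] := boolP (within lo' hi' x).
  rewrite eq_sym in xy.
  move=> xI'; have [[S1 S2]|[lo1 [hi1 [C D]]]] := sameY _ xc xI' xy; first by left.
  by right; exists lo1, hi1; split=> //; rewrite eq_sym.
case: Hx => [xS|[lo1 [hi1 [C W loP hiP]]]].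
  case: Hy => [yS|[lo1 [hi1 [C W loP hiP]]]]; first by left.
  right; exists lo1, hi1; split=> //; move: W xI' loP hiP; rewrite /within; clear; lia.
right; exists lo1, hi1; split=> //; move: W yI loP hiP; rewrite /within; clear; lia.
Qed.

(** * Recovering a code from its edges and marks *)

Definition joined (D : seq (nat * nat)) x y := ((x, y) \in D) || ((y, x) \in D).

(** The first vertex of a nonempty wing is connected to the attachment vertex: it is the child [v],
    or the first vertex of the left wing of [v]. *)
Lemma wing_reach a s c (X : pred nat) : ~~ is_nil c ->
  (forall x y, (x, y) \in edges true a s c -> X x = X y) -> X s = X a.
Proof.
elim: c a s => // m l IHl g _ r _ t _ a s _ H.
have va : X (s + sz l) = X a by apply/esym/H/edges_node_att.
case: l IHl H va => [|m' l' g' r' t'] IHl H va; first by rewrite -va addn0.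
rewrite -va; apply: IHl => // x y xy; apply: H; exact: edges_nodeL.
Qed.

Section Split.
Variables (b : bool) (a s : nat) (m : bool) (l g r t : code)
  (m' : bool) (l' g' r' t' : code).
Let c := Node m l g r t.
Let c' := Node m' l' g' r' t'.
Hypotheses (out : outside b a s c) (wfc : wf b c) (szE : sz c = sz c')
  (E : forall x y, joined (edges b a s c) x y = joined (edges b a s c') x y).

Lemma outside_same_size : outside b a s c'. Proof. by rewrite /outside -szE; apply: out. Qed.

Lemma joinedE x y : (x, y) \in edges b a s c -> joined (edges b a s c') x y.
Proof. by rewrite -E /joined => ->. Qed.

(** With an attachment vertex, the root is its leftmost neighbour in the interval, which both
    decodings must agree on; without one, the left wing is empty. *)
Lemma root_le : sz l <= sz l'.
Proof.
have [bT|/negPf bF] := boolP b; last first.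
  by move: wfc; rewrite /= bF => /and5P[_ _ _ _ /and3P[]]; case: (l).
have J : joined (edges b a s c) a (s + sz l') by rewrite E /joined edges_node_att.
have := outsideP out bT => Ha.
case/orP: J => /edgesP; clear -Ha; case; lia.
Qed.

(* Under the second decoding the interval following the root vertex is a union of
   components; the wings of the first decoding cannot start inside it. *)
Lemma gap_le : sz l = sz l' -> sz g' <= sz g.
Proof.
move=> El; rewrite leqNgt; apply/negP => lt_g.
have [_ _ C] : closed_itv b a s c' (s + sz l').+1 ((s + sz l').+1 + sz g').
  apply: closed_gap; exact: outside_same_size.
have C1 x y : (x, y) \in edges b a s c ->
    within (s + sz l').+1 ((s + sz l').+1 + sz g') x
    = within (s + sz l').+1 ((s + sz l').+1 + sz g') y.
  by move/joinedE => /orP[/C|/C].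
have := outsideP out => Ha.
case: (boolP (is_nil r)) => [r0|rN]; last first.
  have := wing_reach rN (fun x y xy => C1 x y (edges_nodeR _ _ _ _ xy)).
  by rewrite /within; clear -lt_g El; lia.
have r0' : sz r = 0 by case: (r) r0.
case: (boolP (is_nil t)) => [t0|tN].
  have t0' : sz t = 0 by case: (t) t0.
  by move: szE; rewrite /c /c' /=; clear -lt_g El r0' t0'; lia.
have bT : b by move: wfc tN; case: (b) => //= /and5P[_ _ _ _ /and3P[_ ->]].
have := @wing_reach a ((s + sz l).+1 + sz g + sz r) t _ tN _.
move/(_ (within (s + sz l').+1 ((s + sz l').+1 + sz g'))).
have H x y : (x, y) \in edges true a ((s + sz l).+1 + sz g + sz r) t ->
    (x, y) \in edges b a s c.
  by move=> xy; apply: edges_nodeT; rewrite bT.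
move/(_ (fun x y xy => C1 x y (H x y xy))).
by have := Ha bT; move: szE; rewrite /within /c /c' /=; clear -lt_g El r0'; lia.
Qed.

(** Under the second decoding only the edge from [a] to the root leaves [X]. Were [r'] longer than
    [r], a nonempty [t] would start inside [X], and its connection to [a] would use another edge
    leaving [X]; an empty [t] contradicts the sizes. *)
Lemma right_le : sz l = sz l' -> sz g = sz g' -> sz r' <= sz r.
Proof.
move=> El Eg; rewrite leqNgt; apply/negP => lt_r.
pose X := within s ((s + sz l').+1 + sz g' + sz r').
have Ha := outsideP out.
have C1 x y : (x, y) \in edges b a ((s + sz l).+1 + sz g + sz r) t -> X x = X y.
  move=> xy; have := joinedE (edges_nodeT m xy) => xy'.
  have := edges_range xy => R; apply/eqP/negPn/negP => D.
  have key u w : (u, w) \in edges b a s c' -> X u != X w -> [/\ b, u = a & w = s + sz l'].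
    by move=> uw D'; apply: (cutV outside_same_size uw D').
  case/orP: xy' => [/key/(_ D)|/key]; last first.
    by rewrite eq_sym => /(_ D) [/Ha]; move: R El; rewrite /c /=; clear; lia.
  by case=> _ _; move: R El; clear; lia.
case: (boolP (is_nil t)) => [t0|tN].
  have t0' : sz t = 0 by case: (t) t0.
  by move: szE; rewrite /c /c' /=; clear -lt_r El Eg t0'; lia.
have bT : b by move: wfc tN; case: (b) => //= /and5P[_ _ _ _ /and3P[_ ->]].
rewrite bT in C1.
have := wing_reach tN C1.
by have := Ha bT; move: szE; rewrite /X /within /c /c' /=; clear -lt_r El Eg; lia.
Qed.
End Split.

Section Restrict.
Variables (b : bool) (a s : nat) (m : bool) (l g r t : code).
Let c := Node m l g r t.
Let v := s + sz l.
Hypothesis out : outside b a s c.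

Lemma edges_restrictL x y : ((x, y) \in edges true v s l) =
  [&& (x, y) \in edges b a s c, s <= x <= v & s <= y <= v].
Proof.
have Ha := outsideP out; apply/idP/and3P => [xy|[/edgesP]].
  by split; [exact: edges_nodeL | |]; have := edges_range xy; rewrite /v; lia.
by rewrite /v; case=> //; lia.
Qed.

Lemma edges_restrictG x y : ((x, y) \in edges false 0 v.+1 g) =
  [&& (x, y) \in edges b a s c, v < x < v.+1 + sz g & v < y < v.+1 + sz g].
Proof.
have Ha := outsideP out; apply/idP/and3P => [xy|[/edgesP]].
  by split; [exact: edges_nodeG | |]; have := edges_range xy; rewrite /v; lia.
by rewrite /v; case=> //; lia.
Qed.

Lemma edges_restrictR x y : ((x, y) \in edges true v (v.+1 + sz g) r) =
  [&& (x, y) \in edges b a s c,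
      (x == v) || (v.+1 + sz g <= x < v.+1 + sz g + sz r) &
      (y == v) || (v.+1 + sz g <= y < v.+1 + sz g + sz r)].
Proof.
have Ha := outsideP out; apply/idP/and3P => [xy|[/edgesP]].
  by split; [exact: edges_nodeR | |]; have := edges_range xy; rewrite /v; lia.
by rewrite /v; case=> //; lia.
Qed.

Lemma edges_restrictT x y : ((x, y) \in edges b a (v.+1 + sz g + sz r) t) =
  [&& (x, y) \in edges b a s c,
      b && (x == a) || (v.+1 + sz g + sz r <= x < s + sz c) &
      b && (y == a) || (v.+1 + sz g + sz r <= y < s + sz c)].
Proof.
have Ha := outsideP out; apply/idP/and3P => [xy|[/edgesP]].
  by split; [exact: edges_nodeT | |]; have := edges_range xy; rewrite /v /c /=; lia.
by rewrite /v /c /=; case=> //; lia.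
Qed.

Let and3_or (e e' p q : bool) : [&& e, p & q] || [&& e', q & p] = [&& e || e', p & q].
Proof. by case: e e' p q => [] [] [] []. Qed.

Lemma joined_restrictL x y : joined (edges true v s l) x y =
  [&& joined (edges b a s c) x y,
      s <= x <= v & s <= y <= v].
Proof. by rewrite /joined !edges_restrictL and3_or. Qed.

Lemma joined_restrictG x y : joined (edges false 0 v.+1 g) x y =
  [&& joined (edges b a s c) x y,
      v < x < v.+1 + sz g & v < y < v.+1 + sz g].
Proof. by rewrite /joined !edges_restrictG and3_or. Qed.

Lemma joined_restrictR x y : joined (edges true v (v.+1 + sz g) r) x y =
  [&& joined (edges b a s c) x y,
      (x == v) || (v.+1 + sz g <= x < v.+1 + sz g + sz r) &
      (y == v) || (v.+1 + sz g <= y < v.+1 + sz g + sz r)].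
Proof. by rewrite /joined !edges_restrictR and3_or. Qed.

Lemma joined_restrictT x y : joined (edges b a (v.+1 + sz g + sz r) t) x y =
  [&& joined (edges b a s c) x y,
      b && (x == a) || (v.+1 + sz g + sz r <= x < s + sz c) &
      b && (y == a) || (v.+1 + sz g + sz r <= y < s + sz c)].
Proof. by rewrite /joined !edges_restrictT and3_or. Qed.

End Restrict.

(** The three comparisons, used in both directions, make the two decodings split the interval at the
    same places. Each part is then the restriction of the common edges and marks to its own
    vertices. *)
Lemma code_inj b a s c c' : outside b a s c -> wf b c -> wf b c' -> sz c = sz c' ->
  (forall x y, joined (edges b a s c) x y = joined (edges b a s c') x y) ->
  marks s c =i marks s c' -> c = c'.
Proof.
elim: c b a s c' => [|m l IHl g IHg r IHr t IHt] b a s [|m' l' g' r' t'] // out wfc wfc' szE E M.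
have out' := outside_same_size out szE.
have E' x y := esym (E x y); have szE' := esym szE.
have El : sz l = sz l'.
  by apply/eqP; rewrite eqn_leq (root_le out wfc E) (root_le out' wfc' E').
have Eg : sz g = sz g'.
  apply/eqP; rewrite eqn_leq (gap_le out wfc szE E El).
  by rewrite (gap_le out' wfc' szE' E' (esym El)).
have Er : sz r = sz r'.
  apply/eqP; rewrite eqn_leq (right_le out wfc szE E El Eg).
  by rewrite (right_le out' wfc' szE' E' (esym El) (esym Eg)).
have Et : sz t = sz t' by move: szE => /=; lia.
have [wfl wfg wfr wft wfb] : [/\ wf true l, wf false g, wf true r, wf true t &
    b || [&& is_nil l, is_nil t & m + nskel r <= 1]].
  by move: wfc => /= /and5P[].
have wft1 : wf b t by move: wfb wft; case: (b) => //= /and3P[_]; case: (t).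
have [wfl' wfg' wfr' wft' wfb'] : [/\ wf true l', wf false g', wf true r', wf true t' &
    b || [&& is_nil l', is_nil t' & m' + nskel r' <= 1]].
  by move: wfc' => /= /and5P[].
have wft1' : wf b t' by move: wfb' wft'; case: (b) => //= /and3P[_]; case: (t').
congr Node.
- by rewrite (marks_restrictV s m l g r t) M El -marks_restrictV.
- apply: (IHl _ _ _ _ (@outsideL s l)) => //.
    by move=> x y; rewrite (joined_restrictL out) E El -(joined_restrictL out').
  by move=> x; rewrite (marks_restrictL s m l g r t) M El -marks_restrictL.
- apply: (IHg _ _ _ _ (@outsideG s l g)) => //.
    by move=> x y; rewrite (joined_restrictG out) E El Eg -(joined_restrictG out').
  by move=> x; rewrite (marks_restrictG s m l g r t) M El Eg -marks_restrictG.
- apply: (IHr _ _ _ _ (@outsideR s l g r)) => //.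
    by move=> x y; rewrite (joined_restrictR out) E El Eg Er -(joined_restrictR out').
  by move=> x; rewrite (marks_restrictR s m l g r t) M El Eg Er -marks_restrictR.
- apply: (IHt _ _ _ _ (outsideT out)) => //.
    by move=> x y; rewrite (joined_restrictT out) E El Eg Er szE -(joined_restrictT out').
  by move=> x; rewrite (marks_restrictT s m l g r t) M El Eg Er Et -marks_restrictT.
Qed.

Lemma sorted_marks s c : sorted ltn (marks s c).
Proof.
elim: c s => //= m l IHl g IHg r IHr t IHt s.
have lt_cat (u w : seq nat) : sorted ltn u -> sorted ltn w ->
    (forall x y, x \in u -> y \in w -> x < y) -> sorted ltn (u ++ w).
  rewrite !sorted_pairwise ?pairwise_cat; try exact: ltn_trans.
  move=> -> -> H; rewrite !andbT; apply/allrelP => x y; exact: H.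
apply: (lt_cat _ _ (IHl _)).
  apply: (lt_cat); first by case: (m).
    apply: (lt_cat _ _ (IHg _)).
      apply: (lt_cat _ _ (IHr _) (IHt _)) => x y /marks_range + /marks_range.
      by clear; lia.
    by move=> x y /marks_range + /[!mem_cat] /orP[] /marks_range; clear; lia.
  move=> x y; case: (m) => //; rewrite inE => /eqP -> /[!mem_cat].
  by case/or3P=> /marks_range; clear; lia.
move=> x y /marks_range xR /[!mem_cat] /or4P[|/marks_range|/marks_range|/marks_range];
  try by move: xR; clear; lia.
by case: (m) => //; rewrite inE => /eqP ->; move: xR; clear; lia.
Qed.

(** * Staircases *)

(** Every edge is a bridge, witnessed by a set [S] that no other edge enters or leaves; edges are
    recorded in one direction only. *)
Definition bridged (V : eqType) (e : rel V) := forall x y, e x y ->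
  exists S : pred V, S x != S y /\
    forall x' y', e x' y' -> S x' != S y' -> x' = x /\ y' = y.

Definition add_edge (V : eqType) (e : rel V) x y : rel V :=
  fun x' y' => (x' == x) && (y' == y) || e x' y'.

(** The endpoint [z] is new. The singleton of [z] cuts the new edge; an older cut is changed at [z]
    alone, to agree with [t], so that the new edge does not cross it. *)
Lemma bridged_pendant (V : eqType) (e : rel V) x y z t : x != y ->
  (z = x /\ t = y) \/ (z = y /\ t = x) -> (forall x' y', e x' y' -> z != x' /\ z != y') ->
  bridged e -> bridged (add_edge e x y).
Proof.
move=> xy zt zN br x1 y1 /orP[/andP[/eqP -> /eqP ->]|e1].
  exists (pred1 z); split=> [|x' y' /orP[/andP[/eqP-> /eqP->]//|/zN[]]] /=.
    by case: zt => -[-> _]; rewrite eqxx ?[y == x]eq_sym (negPf xy).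
  by rewrite ![z == _]eq_sym => /negPf-> /negPf->.
have [S [Sxy SU]] := br _ _ e1.
have tz : t != z by case: zt => -[-> ->]; rewrite // eq_sym.
pose S' v := if v == z then S t else S v.
have S'E x' y' : e x' y' -> S' x' = S x' /\ S' y' = S y'.
  by move=> /zN[] /negPf zx /negPf zy; rewrite /S' ![_ == z]eq_sym zx zy.
exists S'; split; first by have [-> ->] := S'E _ _ e1.
move=> x' y' /orP[/andP[/eqP -> /eqP ->]|e']; last first.
  by have [-> ->] := S'E _ _ e'; apply: SU.
have S't : S' t = S t by rewrite /S' (negPf tz).
have S'z : S' z = S t by rewrite /S' eqxx.
by move: zt S't S'z => [] [-> ->] -> ->; rewrite eqxx.
Qed.

(** Delannoy paths on the grid of marks: the edges are the visited grid points, and a diagonal step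
    separates two edges without common endpoint. *)
Fixpoint stairs u us : nat -> seq nat -> seq (seq (nat * nat)) :=
  fix stairs_u l ls := map (cons (u, l))
    match us, ls with
    | [::], [::] => [:: [::]]
    | [::], l' :: ls' => stairs_u l' ls'
    | u' :: us', [::] => stairs u' us' l [::]
    | u' :: us', l' :: ls' =>
        stairs u' us' l (l' :: ls') ++ stairs_u l' ls' ++ stairs u' us' l' ls'
    end.

Lemma stairs_consE u u' us l l' ls : stairs u (u' :: us) l (l' :: ls) =
  map (cons (u, l)) (stairs u' us l (l' :: ls) ++ stairs u (u' :: us) l' ls ++
                     stairs u' us l' ls).
Proof. by []. Qed.

Inductive stair : nat -> seq nat -> nat -> seq nat -> seq (nat * nat) -> Prop :=
  | StairNil u l : stair u [::] l [::] [:: (u, l)]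
  | StairU u u' us l ls E : stair u' us l ls E -> stair u (u' :: us) l ls ((u, l) :: E)
  | StairL u us l l' ls E : stair u us l' ls E -> stair u us l (l' :: ls) ((u, l) :: E)
  | StairUL u u' us l l' ls E :
      stair u' us l' ls E -> stair u (u' :: us) l (l' :: ls) ((u, l) :: E).

Lemma stairs_stair u us l ls E : E \in stairs u us l ls -> stair u us l ls E.
Proof.
elim: us u l ls E => [|u' us IHu] u l ls; elim: ls l => [|l' ls IHl] l E /=.
- by rewrite inE => /eqP->; constructor.
- by case/mapP=> T /IHl ? ->; constructor.
- by case/mapP=> T /IHu ? ->; constructor.
- case/mapP=> T; rewrite !mem_cat => /or3P[/IHu|/IHl|/IHu] ? ->.
  + exact: StairU.
  + exact: StairL.
  + exact: StairUL.
Qed.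

Lemma stair_head u us l ls E : stair u us l ls E -> (u, l) \in E.
Proof. by case=> *; rewrite inE eqxx. Qed.

Lemma stair_sub u us l ls E x y : stair u us l ls E -> (x, y) \in E ->
  x \in u :: us /\ y \in l :: ls.
Proof.
elim=> {u us l ls E} [u l|u u' us l ls E _ IH|u us l l' ls E _ IH|u u' us l l' ls E _ IH].
- by rewrite inE => /eqP[-> ->]; rewrite !mem_head.
- rewrite inE => /orP[/eqP[-> ->]|/IH[]]; rewrite ?mem_head //.
  by move=> xu ->; rewrite inE xu orbT.
- rewrite inE => /orP[/eqP[-> ->]|/IH[]]; rewrite ?mem_head //.
  by move=> -> yl; rewrite [_ \in l :: _]inE yl orbT.
- rewrite inE => /orP[/eqP[-> ->]|/IH[]]; rewrite ?mem_head //.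
  by move=> xu yl; rewrite inE xu [_ \in l :: _]inE yl !orbT.
Qed.

Lemma stair_coverU u us l ls E x : stair u us l ls E -> x \in u :: us ->
  exists y, (x, y) \in E.
Proof.
elim=> {u us l ls E} [u l|u u' us l ls E _ IH|u us l l' ls E _ IH|u u' us l l' ls E _ IH].
- by rewrite inE => /eqP->; exists l; rewrite inE.
- rewrite inE => /orP[/eqP->|/IH[y xy]]; first by exists l; rewrite mem_head.
  by exists y; rewrite inE xy orbT.
- by move=> /IH[y xy]; exists y; rewrite inE xy orbT.
- rewrite inE => /orP[/eqP->|/IH[y xy]]; first by exists l; rewrite mem_head.
  by exists y; rewrite inE xy orbT.
Qed.

Lemma stair_coverL u us l ls E y : stair u us l ls E -> y \in l :: ls ->
  exists x, (x, y) \in E.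
Proof.
elim=> {u us l ls E} [u l|u u' us l ls E _ IH|u us l l' ls E _ IH|u u' us l l' ls E _ IH].
- by rewrite inE => /eqP->; exists u; rewrite inE.
- by move=> /IH[x xy]; exists x; rewrite inE xy orbT.
- rewrite inE => /orP[/eqP->|/IH[x xy]]; first by exists u; rewrite mem_head.
  by exists x; rewrite inE xy orbT.
- rewrite inE => /orP[/eqP->|/IH[x xy]]; first by exists u; rewrite mem_head.
  by exists x; rewrite inE xy orbT.
Qed.

Lemma path_ltn_le u us x : path ltn u us -> x \in u :: us -> u <= x.
Proof.
move=> /(order_path_min ltn_trans)/allP H; rewrite inE => /orP[/eqP->//|/H].
exact: ltnW.
Qed.

Lemma stair_ge u us l ls E x y : stair u us l ls E -> path ltn u us -> path ltn l ls ->
  (x, y) \in E -> u <= x /\ l <= y.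
Proof. by move=> st pu pl /(stair_sub st)[/(path_ltn_le pu) ? /(path_ltn_le pl)]. Qed.

Lemma stair_mono u us l ls E x y x' y' : stair u us l ls E ->
  path ltn u us -> path ltn l ls ->
  (x, y) \in E -> (x', y') \in E -> x < x' -> y <= y'.
Proof.
move=> st; elim: st => {u us l ls E}
  [u l|u u' us l ls E st IH|u us l l' ls E st IH|u u' us l l' ls E st IH] /=.
- by move=> _ _; rewrite !inE => /eqP[-> ->] /eqP[-> ->].
- move=> /andP[uu pu] pl; rewrite !inE => /orP[/eqP[-> ->]|E1] /orP[/eqP[-> ->]|E2] //.
  + by have := stair_ge st pu pl E2; lia.
  + by have := stair_ge st pu pl E1; lia.
  + exact: IH.
- move=> pu /andP[ll pl]; rewrite !inE => /orP[/eqP[-> ->]|E1] /orP[/eqP[-> ->]|E2] //.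
  + by have := stair_ge st pu pl E2; lia.
  + by have := stair_ge st pu pl E1; lia.
  + exact: IH.
- move=> /andP[uu pu] /andP[ll pl]; rewrite !inE => /orP[/eqP[-> ->]|E1] /orP[/eqP[-> ->]|E2] //.
  + by have := stair_ge st pu pl E2; lia.
  + by have := stair_ge st pu pl E1; lia.
  + exact: IH.
Qed.

Definition bip (E : seq (nat * nat)) : rel (nat + nat) := fun v w =>
  match v, w with inl x, inr y => (x, y) \in E | _, _ => false end.

Lemma bip_cons u l E : bip ((u, l) :: E) =2 add_edge (bip E) (inl u) (inr l).
Proof. by case=> x; case=> y; rewrite /add_edge /= ?inE ?xpair_eqE ?andbF. Qed.

Lemma eq_bridged (V : eqType) (e e' : rel V) : e =2 e' -> bridged e -> bridged e'.
Proof.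
move=> E br x y; rewrite -E => /br[S [Sxy SU]]; exists S; split=> // x' y'.
by rewrite -E; apply: SU.
Qed.

(** Each step abandons an endpoint of the current edge, [u] if the upper mark advances and [l] if
    only the lower one does, which makes this edge pendant to the rest of the staircase. *)
Lemma stair_bridged u us l ls E : stair u us l ls E ->
  path ltn u us -> path ltn l ls -> bridged (bip E).
Proof.
move=> st; elim: st => {u us l ls E}
  [u l|u u' us l ls E st IH|u us l l' ls E st IH|u u' us l l' ls E st IH] /=.
- move=> _ _; apply: (eq_bridged (fun x y => esym (bip_cons u l [::] x y))).
  apply: (@bridged_pendant _ _ _ _ (inl u) (inr l)) => //; first by left.
    by move=> [x|x] [y|y].
  by move=> [x|x] [y|y].
- move=> /andP[uu pu] pl; apply: (eq_bridged (fun x y => esym (bip_cons u l E x y))).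
  apply: (@bridged_pendant _ _ _ _ (inl u) (inr l)) => //; [by left| |exact: IH].
  move=> [x|x] [y|y] //= /(stair_ge st pu pl) [ux _]; split=> //.
  by apply/eqP => -[]; lia.
- move=> pu /andP[ll pl]; apply: (eq_bridged (fun x y => esym (bip_cons u l E x y))).
  apply: (@bridged_pendant _ _ _ _ (inr l) (inl u)) => //; [by right| |exact: IH].
  move=> [x|x] [y|y] //= /(stair_ge st pu pl) [_ ly]; split=> //.
  by apply/eqP => -[]; lia.
- move=> /andP[uu pu] /andP[ll pl]; apply: (eq_bridged (fun x y => esym (bip_cons u l E x y))).
  apply: (@bridged_pendant _ _ _ _ (inl u) (inr l)) => //; [by left| |exact: IH].
  move=> [x|x] [y|y] //= /(stair_ge st pu pl) [ux _]; split=> //.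
  by apply/eqP => -[]; lia.
Qed.

Lemma mem_cons_inj (T : eqType) (x : T) (s1 s2 : seq T) : x \notin s1 -> x \notin s2 ->
  x :: s1 =i x :: s2 -> s1 =i s2.
Proof.
move=> /negPf x1 /negPf x2 H y; have := H y; rewrite !inE.
by case: eqP => // -> _; rewrite x1 x2.
Qed.

(** The first step can be read off the edge set: [(u', l)] occurs only if the upper mark advances
    alone, [(u, l')] only if the lower one does, and neither after a diagonal step. *)
Lemma stair_inj u us l ls E E' : stair u us l ls E -> stair u us l ls E' ->
  path ltn u us -> path ltn l ls -> E =i E' -> E = E'.
Proof.
move=> st; elim: st E' => {u us l ls E}
  [u l|u u' us l ls E st IH|u us l l' ls E st IH|u u' us l l' ls E st IH] E' st'.
- by inversion st'.
- move=> /= /andP[uu pu] pl EE.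
  have N : (u, l) \notin E by apply/negP => /(stair_ge st pu pl); lia.
  have := stair_head st; move: EE.
  inversion st' as [|? ? ? ? ? F sF|? ? ? ? ? F sF|? ? ? ? ? ? F sF]; subst.
  + move=> EE _; congr cons; apply: IH => //; apply: mem_cons_inj EE => //.
    by apply/negP => /(stair_ge sF pu pl); lia.
  + move=> EE H; move: pl => /= /andP[ll pl'].
    have := EE (u, l'); rewrite !inE (stair_head sF) orbT xpair_eqE eqxx.
    rewrite [l' == l]gtn_eqF //= => /(stair_ge st pu); rewrite /= ll pl' => /(_ isT).
    lia.
  + move=> EE H; move: pl => /= /andP[ll pl'].
    have := EE (u', l); rewrite !inE H orbT xpair_eqE eqxx.
    rewrite [u' == u]gtn_eqF //= => /esym/(stair_ge sF pu pl'); lia.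
- move=> /= pu /andP[ll pl] EE.
  have N : (u, l) \notin E by apply/negP => /(stair_ge st pu pl); lia.
  have := stair_head st; move: EE.
  inversion st' as [|? ? ? ? ? F sF|? ? ? ? ? F sF|? ? ? ? ? ? F sF]; subst.
  + move=> EE H; move: pu => /= /andP[uu pu'].
    have := EE (u, l'); rewrite !inE H orbT xpair_eqE eqxx.
    rewrite [l' == l]gtn_eqF //= => /esym/(stair_ge sF pu'); rewrite /= ll pl => /(_ isT).
    lia.
  + move=> EE _; congr cons; apply: IH => //; apply: mem_cons_inj EE => //.
    by apply/negP => /(stair_ge sF pu pl); lia.
  + move=> EE H; move: pu => /= /andP[uu pu'].
    have := EE (u, l'); rewrite !inE H orbT xpair_eqE eqxx.
    rewrite [l' == l]gtn_eqF //= => /esym/(stair_ge sF pu' pl); lia.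
- move=> /= /andP[uu pu] /andP[ll pl] EE.
  have N : (u, l) \notin E by apply/negP => /(stair_ge st pu pl); lia.
  have := stair_head st; move: EE.
  inversion st' as [|? ? ? ? ? F sF|? ? ? ? ? F sF|? ? ? ? ? ? F sF]; subst.
  + move=> EE _; have := EE (u', l); rewrite !inE (stair_head sF) orbT xpair_eqE eqxx.
    rewrite [u' == u]gtn_eqF //= => /(stair_ge st pu pl); lia.
  + move=> EE _; have := EE (u, l'); rewrite !inE (stair_head sF) orbT xpair_eqE eqxx.
    rewrite [l' == l]gtn_eqF //= => /(stair_ge st pu pl); lia.
  + move=> EE _; congr cons; apply: IH => //; apply: mem_cons_inj EE => //.
    by apply/negP => /(stair_ge sF pu pl); lia.
Qed.

Lemma stairs_uniq u us l ls : path ltn u us -> path ltn l ls -> uniq (stairs u us l ls).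
Proof.
have cons_inj (x : nat * nat) : injective (cons x) by move=> s1 s2 [].
elim: us u l ls => [|u' us IHu] u l ls; elim: ls l => [|l' ls IHl] l.
- by [].
- by move=> _ /andP[ll pl]; rewrite map_inj_uniq // IHl.
- by move=> /andP[uu pu] _; rewrite /= map_inj_uniq // IHu.
move=> up /andP[ll pl]; have /andP[uu pu] := up.
rewrite stairs_consE map_inj_uniq // !cat_uniq.
have pl0 : path ltn l (l' :: ls) by apply/andP.
rewrite IHu // IHl // (IHu u' l' ls) // ?andbT ?andTb.
apply/andP; split; apply/hasPn => E.
  rewrite mem_cat => /orP[] /stairs_stair st; apply/negP => /stairs_stair st'.
    by have := stair_ge st' pu pl0 (stair_head st); lia.
  by have := stair_ge st pu pl (stair_head st'); lia.
move=> /stairs_stair st; apply/negP => /stairs_stair st'.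
by have := stair_ge st pu pl (stair_head st'); lia.
Qed.

(** * Counting staircases by Delannoy numbers *)

Definition delannoy n a b := \sum_(k < n.+1) 'C(a, k) * 'C(b, k) * 2 ^ k.

Lemma delannoy_0l n b : delannoy n 0 b = 1.
Proof.
rewrite /delannoy big_ord_recl big1 => [|k _]; last by rewrite bin_small.
by rewrite !bin0.
Qed.

Lemma delannoy_0r n a : delannoy n a 0 = 1.
Proof.
rewrite /delannoy big_ord_recl big1 => [|k _]; last by rewrite ['C(0, _)]bin_small // muln0.
by rewrite !bin0.
Qed.

(** By Pascal's rule each product of binomials is a sum of three products minus a fourth. The third
    and fourth sums are [2 * delannoy n a b] and [delannoy n a b - 1], leaving one copy. As [a < n],
    the truncation at [n] loses nothing. *)
Lemma delannoyS n a b : a < n ->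
  delannoy n a.+1 b.+1 = delannoy n a b.+1 + delannoy n a.+1 b + delannoy n a b.
Proof.
move=> an.
have E (p q : nat) : delannoy n p q = 1 + \sum_(k < n) 'C(p, k.+1) * 'C(q, k.+1) * 2 ^ k.+1.
  by rewrite /delannoy big_ord_recl !bin0.
have E2 : \sum_(k < n) 'C(a, k) * 'C(b, k) * 2 ^ k.+1 = 2 * delannoy n a b.
  rewrite /delannoy big_ord_recr /= bin_small // addn0 big_distrr /=.
  by apply: eq_bigr => k _; rewrite expnS mulnCA.
suff -> : delannoy n a.+1 b.+1 = 1 + (\sum_(k < n) 'C(a, k.+1) * 'C(b.+1, k.+1) * 2 ^ k.+1
    + \sum_(k < n) 'C(a.+1, k.+1) * 'C(b, k.+1) * 2 ^ k.+1
    + \sum_(k < n) 'C(a, k) * 'C(b, k) * 2 ^ k.+1)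
    - \sum_(k < n) 'C(a, k.+1) * 'C(b, k.+1) * 2 ^ k.+1.
  by rewrite E2 (E a b.+1) (E a.+1 b); have := E a b; lia.
rewrite E -addnBA; last first.
  rewrite -addnA; apply: leq_trans (leq_addr _ _); apply: leq_sum => k _.
  by rewrite leq_mul2r leq_mul2l binS leq_addr !orbT.
congr (1 + _); rewrite -!big_split -sumnB /=.
  by apply: eq_bigr => k _; rewrite !binS; nia.
by move=> k _; rewrite !binS; nia.
Qed.

Lemma size_stairs n u us l ls : size us <= n ->
  size (stairs u us l ls) = delannoy n (size us) (size ls).
Proof.
elim: us u l ls => [|u' us IHu] u l ls; elim: ls l => [|l' ls IHl] l //= un.
- by rewrite delannoy_0l.
- by rewrite size_map IHl // !delannoy_0l.
- by rewrite size_map IHu 1?ltnW // !delannoy_0r.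
- by rewrite size_map !size_cat IHl // !IHu 1?ltnW //= delannoyS // addnA.
Qed.

(** * Drawings *)

Section Glue.
Variables (V : eqType) (e1 e2 : rel V) (M : pred V).

(** Connectedness in [e1], by duality with the predicates constant along edges. *)
Definition linked u v :=
  `[< forall X : pred V, (forall x y, e1 x y -> X x = X y) -> X u = X v >].

Lemma linked_refl u : linked u u. Proof. exact/asboolP. Qed.

Lemma linked_edge u x y : e1 x y -> linked u x = linked u y.
Proof.
by move=> xy; apply/asboolP/asboolP => H X HX; rewrite (H X HX) (HX x y).
Qed.

Hypothesis separated : forall x y, M x -> M y -> x != y ->
  exists X : pred V, (forall u v, e1 u v -> X u = X v) /\ X x != X y.

Lemma linked_marks x u v : M u -> M v -> linked x u -> linked x v -> u = v.
Proof.
move=> Mu Mv /asboolP xu /asboolP xv; apply/eqP/negPn/negP => /(separated Mu Mv)[X [HX]].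
by rewrite -xu // -xv // eqxx.
Qed.

(* A cut of a marked component may be taken on the side avoiding its only mark,
   so that no edge between marks crosses it. *)
Lemma bridged_glue : bridged e1 -> bridged e2 -> (forall x y, e2 x y -> M x /\ M y) ->
  bridged (fun x y => e1 x y || e2 x y).
Proof.
move=> br1 br2 eM x y /orP[xy|xy].
- have [S [Sxy SU]] := br1 _ _ xy.
  pose markin := `[< exists z, [/\ M z, linked x z & S z] >].
  pose S' v := linked x v && (markin != S v).
  have xL := linked_refl x; have yL : linked x y by rewrite -(linked_edge x xy).
  exists S'; split.
    by move: Sxy; rewrite /S' xL yL; case: (markin) (S x) (S y) => [] [] [].
  move=> x' y' /orP[xy' D|/eM[Mx My]].
    apply: SU => //; move: D; rewrite /S' (linked_edge x xy').
    by case: linked => //=; case: (markin) (S x') (S y') => [] [] [].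
  have S'F v : M v -> S' v = false.
    move=> Mv; apply/negP => /andP[xv]; rewrite /markin.
    case: asboolP => [[z [Mz xz Sz]]|NS]; first by rewrite -(linked_marks Mz Mv xz xv) Sz.
    by rewrite eq_sym eqbF_neg negbK => Sv; apply: NS; exists v.
  by rewrite !S'F.
- have [S [Sxy SU]] := br2 _ _ xy.
  (* A cut of [e2] matters on marks only: each component of [e1] takes the side of its mark, and
     unmarked ones the outer side, so no edge of [e1] crosses the extended cut. *)
  pose S' v := `[< exists z, [/\ M z, linked z v & S z] >].
  have S'M v : M v -> S' v = S v.
    move=> Mv; apply/asboolP/idP => [[z [Mz zv Sz]]|Sv].
      by rewrite -(linked_marks Mz Mv (linked_refl z) zv).
    by exists v; split=> //; apply: linked_refl.
  have [Mx My] := eM _ _ xy.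
  exists S'; split; first by rewrite !S'M.
  move=> x' y' /orP[xy'|xy']; last by have [Mx' My'] := eM _ _ xy'; rewrite !S'M //; apply: SU.
  suff -> : S' x' = S' y' by rewrite eqxx.
  by apply/asboolP/asboolP => -[z [Mz zv Sz]]; exists z; split=> //;
    rewrite ?(linked_edge z xy') // -(linked_edge z xy').
Qed.

End Glue.

Definition sum_rel (V W : Type) (e1 : rel V) (e2 : rel W) : rel (V + W) := fun x y =>
  match x, y with inl i, inl j => e1 i j | inr i, inr j => e2 i j | _, _ => false end.

Lemma bridged_sum (V W : eqType) (e1 : rel V) (e2 : rel W) :
  bridged e1 -> bridged e2 -> bridged (sum_rel e1 e2).
Proof.
move=> br1 br2 [i|i] [j|j] //= /[dup] ij; [move/br1|move/br2] => -[S [Sij SU]].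
- exists (fun v => if v is inl k then S k else false); split=> // -[k|k] [l|l] //=.
  by move=> kl D; have [-> ->] := SU _ _ kl D.
- exists (fun v => if v is inr k then S k else false); split=> // -[k|k] [l|l] //=.
  by move=> kl D; have [-> ->] := SU _ _ kl D.
Qed.

Definition planar (e : rel nat) := forall i j k l, e i j -> e k l -> ~ (i < k < j /\ j < l).

(** Codes list an edge in either direction; it is oriented here from its smaller end, as [bridged]
    expects. *)
Definition forest_rel (c : code) : rel nat := fun i j =>
  (i < j) && joined (edges false 0 0 c) i j.

Lemma outside0 c : outside false 0 0 c. Proof. by []. Qed.

Lemma forest_range c i j : forest_rel c i j -> i < j < sz c.
Proof. by case/andP=> ij /orP[] /edges_range /=; move: ij; clear; lia. Qed.

Lemma forest_planar c : planar (forest_rel c).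
Proof.
move=> i j k l /andP[ij ijE] /andP[kl klE] H.
have K x y x' y' : minn x y = i -> maxn x y = j -> minn x' y' = k -> maxn x' y' = l ->
    (x, y) \in edges false 0 0 c -> (x', y') \in edges false 0 0 c -> False.
  move=> E1 E2 E3 E4 xy xy'; apply: (edges_noncrossing (@outside0 c) xy xy').
  by rewrite /crossing E1 E2 E3 E4.
by case/orP: ijE => E1; case/orP: klE => E2; apply: (K _ _ _ _ _ _ _ _ E1 E2);
  move: ij kl; clear; lia.
Qed.

Lemma forest_bridged c : bridged (forest_rel c).
Proof.
move=> i j /andP[ij ijE].
have [lo [hi [C U]]] : exists lo hi, within lo hi i != within lo hi j /\
    forall x y, (x, y) \in edges false 0 0 c -> within lo hi x != within lo hi y ->
    (x = i /\ y = j) \/ (x = j /\ y = i).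
  case/orP: ijE => E; have [lo [hi [_ _ C U]]] := edges_cut (@outside0 c) E;
    exists lo, hi; split=> [|x y xy D]; rewrite // 1?eq_sym //.
  - by have [-> ->] := U _ _ xy D; left.
  - by have [-> ->] := U _ _ xy D; right.
exists (within lo hi); split=> // i' j' /andP[ij' /orP[E|E]] D.
  by have := U _ _ E D; move: ij ij'; clear; lia.
by rewrite eq_sym in D; have := U _ _ E D; move: ij ij'; clear; lia.
Qed.

Lemma forest_separated c x y : wf false c -> x \in marks 0 c -> y \in marks 0 c -> x != y ->
  exists X : pred nat, (forall i j, forest_rel c i j -> X i = X j) /\ X x != X y.
Proof.
move=> wfc xc yc xy.
have [[xS yS]|[lo [hi [[_ _ C] D]]]] := marks_separated (@outside0 c) wfc xc yc xy.
  have := wf_false_nskel wfc; rewrite -(size_skel_marks 0).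
  case: skel_marks xS yS => [|u [|//]] //; rewrite !inE => /eqP E1 /eqP E2.
  by rewrite E1 E2 eqxx in xy.
exists (within lo hi); split=> // i j /andP[_ /orP[] /C] //.
Qed.

(* Vertices [inl i] and [inr i] are the [i]-th points of the upper and of the lower
   chain; an edge is recorded in one direction only. *)
Record valid n (g : rel (nat + nat)) : Prop := Valid {
  valid_up : forall i j, g (inl i) (inl j) -> i < j < n;
  valid_low : forall i j, g (inr i) (inr j) -> i < j < n;
  valid_mid : forall i j, g (inl i) (inr j) -> i < n /\ j < n;
  valid_dir : forall i j, g (inr i) (inl j) = false;
  valid_up_planar : planar (fun i j => g (inl i) (inl j));
  valid_low_planar : planar (fun i j => g (inr i) (inr j));
  valid_mono : forall i j k l, g (inl i) (inr j) -> g (inl k) (inr l) -> i < k -> j <= l;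
  valid_bridged : bridged g }.

Definition drawing c1 c2 E : rel (nat + nat) := fun v w =>
  sum_rel (forest_rel c1) (forest_rel c2) v w || bip E v w.

Lemma drawing_valid c1 c2 u us l ls E n : wf false c1 -> wf false c2 ->
  sz c1 = n -> sz c2 = n -> marks 0 c1 = u :: us -> marks 0 c2 = l :: ls ->
  stair u us l ls E -> valid n (drawing c1 c2 E).
Proof.
move=> wf1 wf2 sz1 sz2 m1 m2 st.
have pu : path ltn u us by have := sorted_marks 0 c1; rewrite m1.
have pl : path ltn l ls by have := sorted_marks 0 c2; rewrite m2.
have EM i j : (i, j) \in E -> i \in marks 0 c1 /\ j \in marks 0 c2.
  by rewrite m1 m2; apply: stair_sub.
split; rewrite /drawing /=.
- by move=> i j; rewrite orbF => /forest_range; rewrite sz1.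
- by move=> i j; rewrite orbF => /forest_range; rewrite sz2.
- by move=> i j /EM[/marks_range + /marks_range]; rewrite sz1 sz2.
- by [].
- by move=> i j k k'; rewrite !orbF; apply: forest_planar.
- by move=> i j k k'; rewrite !orbF; apply: forest_planar.
- by move=> i j k k'; apply: stair_mono st pu pl.
- apply: (@bridged_glue _ _ _ (fun v => match v with inl i => i \in marks 0 c1
                                        | inr j => j \in marks 0 c2 end)).
  + move=> [i|i] [j|j] ic jc ij.
    * have [X [HX D]] := forest_separated wf1 ic jc ij.
      exists (fun v => if v is inl k then X k else false).
      by split=> // -[k|k] [k'|k'] //=; apply: HX.
    * by exists (fun v => if v is inl k then true else false); split=> // -[k|k] [k'|k'].
    * by exists (fun v => if v is inl k then true else false); split=> // -[k|k] [k'|k'].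
    * have [X [HX D]] := forest_separated wf2 ic jc ij.
      exists (fun v => if v is inr k then X k else false).
      by split=> // -[k|k] [k'|k'] //=; apply: HX.
  + exact: bridged_sum (@forest_bridged _) (@forest_bridged _).
  + exact: stair_bridged st pu pl.
  + by move=> [i|i] [j|j] //= /EM.
Qed.

Lemma joined_sym D x y : joined D x y = joined D y x.
Proof. by rewrite /joined orbC. Qed.

Lemma forest_rel_inj c c' : wf false c -> wf false c' -> sz c = sz c' ->
  forest_rel c =2 forest_rel c' -> marks 0 c =i marks 0 c' -> c = c'.
Proof.
move=> wfc wfc' szE E; apply: code_inj (@outside0 c) wfc wfc' szE _.
have D c1 x : joined (edges false 0 0 c1) x x = false.
  by apply/negP; rewrite /joined orbb => /(edges_neq (@outside0 c1)); rewrite eqxx.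
move=> x y; case: (ltngtP x y) => [xy|xy|->]; last by rewrite !D.
- by have := E x y; rewrite /forest_rel xy.
- by have := E y x; rewrite /forest_rel xy /= ![joined _ y x]joined_sym.
Qed.

(** The staircase is visible as the edges between the chains. It covers all marks, so the vertices
    it touches are the marks, and together with the edges inside each chain they determine the
    codes. *)
Lemma drawing_inj c1 c2 u us l ls E c1' c2' u' us' l' ls' E' :
  wf false c1 -> wf false c2 -> wf false c1' -> wf false c2' ->
  sz c1 = sz c1' -> sz c2 = sz c2' ->
  marks 0 c1 = u :: us -> marks 0 c2 = l :: ls -> stair u us l ls E ->
  marks 0 c1' = u' :: us' -> marks 0 c2' = l' :: ls' -> stair u' us' l' ls' E' ->
  drawing c1 c2 E =2 drawing c1' c2' E' -> [/\ c1 = c1', c2 = c2' & E = E'].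
Proof.
move=> wf1 wf2 wf1' wf2' sz1 sz2 m1 m2 st m1' m2' st' H.
have EE : E =i E' by move=> [i j]; have := H (inl i) (inr j).
have M1 : marks 0 c1 =i marks 0 c1'.
  move=> x; rewrite m1 m1'; apply/idP/idP.
    by case/(stair_coverU st) => y; rewrite EE => /(stair_sub st')[].
  by case/(stair_coverU st') => y; rewrite -EE => /(stair_sub st)[].
have M2 : marks 0 c2 =i marks 0 c2'.
  move=> x; rewrite m2 m2'; apply/idP/idP.
    by case/(stair_coverL st) => y; rewrite EE => /(stair_sub st')[].
  by case/(stair_coverL st') => y; rewrite -EE => /(stair_sub st)[].
have E1 : c1 = c1'.
  by apply: forest_rel_inj => // i j; have := H (inl i) (inl j); rewrite /drawing /= !orbF.
have E2 : c2 = c2'.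
  by apply: forest_rel_inj => // i j; have := H (inr i) (inr j); rewrite /drawing /= !orbF.
subst c1' c2'; split=> //.
move: m1' m2'; rewrite m1 m2 => -[? ?] [? ?]; subst u' us' l' ls'.
apply: stair_inj st st' _ _ EE.
  by have := sorted_marks 0 c1; rewrite m1.
by have := sorted_marks 0 c2; rewrite m2.
Qed.

(** * Families of distinct drawings and their juxtaposition *)

Definition family n k := exists (I : finType) (g : I -> rel (nat + nat)),
  [/\ #|I| = k, forall i, valid n (g i) & forall i j, g i =2 g j -> i = j].

Lemma family_seq n (X : eqType) (s : seq X) (g : X -> rel (nat + nat)) :
  uniq s -> (forall x, x \in s -> valid n (g x)) ->
  (forall x y, x \in s -> y \in s -> g x =2 g y -> x = y) -> family n (size s).
Proof.
move=> us vs gI; have sP i : tnth (in_tuple s) i \in s := mem_tnth i (in_tuple s).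
exists 'I_(size s), (fun i => g (tnth (in_tuple s) i)); split.
- by rewrite card_ord.
- by move=> i; apply: vs.
- move=> i j /(gI _ _ (sP i) (sP j)) /eqP.
  have x0 := tnth (in_tuple s) i.
  by rewrite !(tnth_nth x0) nth_uniq // => /eqP/val_inj.
Qed.

Definition vertex_index (v : nat + nat) := match v with inl i | inr i => i end.
Definition vertex_shift n (v : nat + nat) : nat + nat :=
  match v with inl i => inl (i - n) | inr i => inr (i - n) end.

(** The lower bounds on the indices are essential: truncated subtraction would send the first [n]
    columns to column 0 of [h]. *)
Definition juxtapose n (g h : rel (nat + nat)) : rel (nat + nat) := fun v w =>
  g v w ||
  [&& n <= vertex_index v, n <= vertex_index w & h (vertex_shift n v) (vertex_shift n w)].

Lemma valid_index n g v w : valid n g -> g v w -> vertex_index v < n /\ vertex_index w < n.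
Proof.
move=> V; case: v w => [i|i] [j|j] /=.
- by move/(valid_up V); clear; lia.
- by move/(valid_mid V).
- by rewrite (valid_dir V).
- by move/(valid_low V); clear; lia.
Qed.

Lemma juxtapose_valid n m g h : valid n g -> valid m h -> valid (n + m) (juxtapose n g h).
Proof.
move=> G H; split; rewrite /juxtapose /=.
- by move=> i j /orP[/(valid_up G)|/and3P[? ? /(valid_up H)]]; lia.
- by move=> i j /orP[/(valid_low G)|/and3P[? ? /(valid_low H)]]; lia.
- by move=> i j /orP[/(valid_mid G)|/and3P[? ? /(valid_mid H)]]; lia.
- by move=> i j; rewrite (valid_dir G) (valid_dir H) !andbF.
- move=> i j k l /orP[/[dup] /(valid_up G) ? E1|/and3P[? ? /[dup] /(valid_up H) ? E1]]
    /orP[/[dup] /(valid_up G) ? E2|/and3P[? ? /[dup] /(valid_up H) ? E2]]; try lia.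
    exact: (valid_up_planar G) E1 E2.
  by have := (valid_up_planar H) _ _ _ _ E1 E2; lia.
- move=> i j k l /orP[/[dup] /(valid_low G) ? E1|/and3P[? ? /[dup] /(valid_low H) ? E1]]
    /orP[/[dup] /(valid_low G) ? E2|/and3P[? ? /[dup] /(valid_low H) ? E2]]; try lia.
    exact: (valid_low_planar G) E1 E2.
  by have := (valid_low_planar H) _ _ _ _ E1 E2; lia.
- move=> i j k l /orP[/[dup] /(valid_mid G) ? E1|/and3P[? ? /[dup] /(valid_mid H) ? E1]]
    /orP[/[dup] /(valid_mid G) ? E2|/and3P[? ? /[dup] /(valid_mid H) ? E2]]; try lia.
    exact: (valid_mono G) E1 E2.
  by have := (valid_mono H) _ _ _ _ E1 E2; lia.
- move=> v w /orP[vw|/and3P[nv nw vw]].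
    have [S [D SU]] := valid_bridged G vw; have [vn wn] := valid_index G vw.
    exists (fun x => S x && (vertex_index x < n)); split; first by rewrite vn wn !andbT.
    move=> x y /orP[xy|/and3P[nx ny _]]; last by rewrite !ltnNge nx ny !andbF.
    by have [-> ->] := valid_index G xy; rewrite !andbT; apply: SU.
  have [S [D SU]] := valid_bridged H vw.
  exists (fun x => S (vertex_shift n x) && (n <= vertex_index x)).
  split; first by rewrite nv nw !andbT.
  have shift_inj x y : n <= vertex_index x -> n <= vertex_index y ->
      vertex_shift n x = vertex_shift n y -> x = y.
    by case: x y => [x|x] [y|y] //= nx ny [] /eqP; rewrite eqn_sub2rE // => /eqP->.
  move=> x y /orP[xy|/and3P[nx ny xy]].
    by have [xn yn] := valid_index G xy; rewrite ![n <= _]leqNgt xn yn !andbF.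
  rewrite nx ny !andbT => Dxy; have [E1 E2] := SU _ _ xy Dxy.
  by split; apply: shift_inj.
Qed.

Lemma juxtapose_inj n m g h g' h' : valid n g -> valid m h -> valid n g' -> valid m h' ->
  juxtapose n g h =2 juxtapose n g' h' -> g =2 g' /\ h =2 h'.
Proof.
have left_eq m1 a b : valid n a -> valid m1 b ->
    forall v w, a v w = [&& vertex_index v < n, vertex_index w < n & juxtapose n a b v w].
  move=> A B v w; apply/idP/idP => [vw|/and3P[vn wn /orP[//|]]].
    by have [-> ->] := valid_index A vw; rewrite /juxtapose vw.
  by rewrite leqNgt vn.
pose add (v : nat + nat) : nat + nat :=
  match v with inl i => inl (i + n) | inr i => inr (i + n) end.
have right_eq m1 a b : valid n a -> valid m1 b ->
    forall v w, b v w = juxtapose n a b (add v) (add w).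
  move=> A B v w.
  have addn_ge x : n <= vertex_index (add x) by case: x => i /=; rewrite leq_addl.
  have addK x : vertex_shift n (add x) = x by case: x => i /=; rewrite addnK.
  rewrite /juxtapose !addn_ge !addK /=; case: (boolP (a _ _)) => // /(valid_index A) [].
  by rewrite ltnNge addn_ge.
move=> G H G' H' E; split=> v w.
  by rewrite (left_eq _ _ _ G H) E -(left_eq _ _ _ G' H').
by rewrite (right_eq _ _ _ G H) E -(right_eq _ _ _ G' H').
Qed.

Lemma family_mul n m k k' : family n k -> family m k' -> family (n + m) (k * k').
Proof.
move=> [I [g [<- Vg gI]]] [J [h [<- Vh hI]]].
exists (I * J)%type, (fun p => juxtapose n (g p.1) (h p.2)); split.
- by rewrite card_prod.
- by move=> p; apply: juxtapose_valid.
- by move=> [i j] [i' j'] /(juxtapose_inj (Vg _) (Vh _) (Vg _) (Vh _)) /= [/gI -> /hI ->].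
Qed.

Lemma family_empty n : family n 1.
Proof.
exists unit, (fun _ _ _ => false); split; [exact: card_unit| |by move=> [] []].
by move=> _; split=> // *; move=> ?.
Qed.

(** The [m] additional columns stay empty; they give access to sizes that are not multiples of
    [n]. *)
Lemma family_exp n k r m : family n k -> family (n * r + m) (k ^ r).
Proof.
move=> F; elim: r => [|r IH]; first by rewrite muln0 expn0; apply: family_empty.
by rewrite mulnS -addnA expnS; apply: family_mul.
Qed.

(** * Enumeration of the codes *)

HB.instance Definition _ := gen_eqMixin code.

Fixpoint nmarks c :=
  if c is Node m l g r t then m + nmarks l + nmarks g + nmarks r + nmarks t else 0.

Lemma size_marks s c : size (marks s c) = nmarks c.
Proof.
elim: c s => //= m l IHl g IHg r IHr t IHt s.
by rewrite !size_cat IHl IHg IHr IHt; case: m => /=; lia.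
Qed.

Lemma nmarks_sz c : nmarks c <= sz c.
Proof. by elim: c => //= m l IHl g IHg r IHr t IHt; case: m; lia. Qed.

Definition nodes m (L G R T : seq code) :=
  [seq Node m p.1.1.1 p.1.1.2 p.1.2 p.2 |
     p <- allpairs pair (allpairs pair (allpairs pair L G) R) T].

Lemma nodesP m L G R T c : reflect
  (exists l g r t, [/\ l \in L, g \in G, r \in R, t \in T & c = Node m l g r t])
  (c \in nodes m L G R T).
Proof.
apply: (iffP mapP) => [[p /allpairsP[[q t] /= [/allpairsP[[o r] /= [/allpairsP[[l g]]]]]]]|].
  by move=> /= [lL gG ->] rR -> tT -> ->; exists l, g, r, t.
move=> [l [g [r [t [lL gG rR tT ->]]]]]; exists (l, g, r, t) => //.
by do 3!apply: allpairs_f => //.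
Qed.

Lemma nodes_uniq m L G R T : uniq L -> uniq G -> uniq R -> uniq T -> uniq (nodes m L G R T).
Proof.
move=> uL uG uR uT; rewrite map_inj_uniq; last first.
  by move=> [[[l g] r] t] [[[l' g'] r'] t'] /= [-> -> -> ->].
by apply: allpairs_uniq; [apply: allpairs_uniq; [apply: allpairs_uniq| |]| |] => // -[? ?] [? ?].
Qed.

Lemma nodes_disjoint m m' L G R T L' G' R' T' :
  [|| m != m', ~~ has (mem L) L', ~~ has (mem R) R' | ~~ has (mem T) T'] ->
  ~~ has (mem (nodes m L G R T)) (nodes m' L' G' R' T').
Proof.
move=> H; apply/hasPn => c /nodesP[l [g [r [t [lL gG rR tT ->]]]]].
apply/negP => /nodesP[l' [g' [r' [t' [lL' _ rR' tT' [E ? ? ? ?]]]]]]; subst l' g' r' t'.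
move: H; rewrite E eqxx /= => /or3P[] /hasPn.
- by move/(_ _ lL); rewrite /= lL'.
- by move/(_ _ rR); rewrite /= rR'.
- by move/(_ _ tT); rewrite /= tT'.
Qed.

(* The codes of depth at most [k] of, respectively, wings without a marked skeleton
   vertex, wings with one marked skeleton vertex, and forests. *)
Fixpoint wings k := if k is k.+1 then
    Nil :: nodes false (wings k) (forests k) (wings k) (wings k) else [:: Nil]
with pwings k := if k is k.+1 then
    nodes true (wings k) (forests k) (wings k) (wings k) ++
    nodes false (pwings k) (forests k) (wings k) (wings k) ++
    nodes false (wings k) (forests k) (pwings k) (wings k) ++
    nodes false (wings k) (forests k) (wings k) (pwings k) else [::]
with forests k := if k is k.+1 then
    Nil :: nodes false [:: Nil] (forests k) (wings k) [:: Nil] ++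
           nodes true [:: Nil] (forests k) (wings k) [:: Nil] ++
           nodes false [:: Nil] (forests k) (pwings k) [:: Nil] else [:: Nil].

Lemma levels_wf k :
  [/\ forall c, c \in wings k -> wf true c /\ nskel c = 0,
      forall c, c \in pwings k -> wf true c /\ nskel c = 1 &
      forall c, c \in forests k -> wf false c].
Proof.
elim: k => [|k [W P F]]; first by split=> // c; rewrite inE => /eqP->.
split=> c /=.
- rewrite inE => /orP[/eqP-> //|/nodesP[l [g [r [t [/W[wl nl] /F wg /W[wr nr] /W[wt nt] ->]]]]]].
  by rewrite /= wl wg wr wt nl nr nt.
- rewrite !mem_cat => /or4P[] /nodesP[l [g [r [t [H1 /F wg H2 H3 ->]]]]] /=.
  + by have [-> ->] := W _ H1; have [-> ->] := W _ H2; have [-> ->] := W _ H3; rewrite wg.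
  + by have [-> ->] := P _ H1; have [-> ->] := W _ H2; have [-> ->] := W _ H3; rewrite wg.
  + by have [-> ->] := W _ H1; have [-> ->] := P _ H2; have [-> ->] := W _ H3; rewrite wg.
  + by have [-> ->] := W _ H1; have [-> ->] := W _ H2; have [-> ->] := P _ H3; rewrite wg.
- rewrite inE !mem_cat => /or4P[/eqP-> //| | | ] /nodesP[l [g [r [t []]]]];
    rewrite !mem_seq1 => /eqP-> /F wg H /eqP-> -> /=; rewrite wg.
  + by have [-> ->] := W _ H.
  + by have [-> ->] := W _ H.
  + by have [-> ->] := P _ H.
Qed.

(** The alternatives of a level differ in the mark of the root or in the wing carrying the marked
    skeleton vertex; [wings] and [pwings] are disjoint because [nskel] is 0 on one and 1 on the
    other. *)
Lemma levels_uniq k : [/\ uniq (wings k), uniq (pwings k) & uniq (forests k)].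
Proof.
elim: k => [//|k [uW uP uF]].
have [W P _] := levels_wf k.
have WP : ~~ has (mem (wings k)) (pwings k).
  by apply/hasPn => c /P[_ c1]; apply/negP => /W[_]; rewrite c1.
have PW : ~~ has (mem (pwings k)) (wings k) by rewrite has_sym.
have NN m L G R T : Nil \notin nodes m L G R T.
  by apply/negP => /nodesP[? [? [? [? []]]]].
have uN : uniq [:: Nil] by [].
split=> /=.
- by rewrite NN nodes_uniq.
- rewrite !cat_uniq !has_cat !negb_or !nodes_uniq //= !andbT.
  by rewrite !nodes_disjoint ?PW ?WP ?orbT.
- rewrite !mem_cat !negb_or !NN !cat_uniq !has_cat !negb_or !nodes_uniq //= !andbT.
  by rewrite !nodes_disjoint ?PW ?WP ?orbT.
Qed.

(* The isolated marked root starts the staircase even if [g] has no mark. *)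
Definition block (g : code) := Node true Nil g Nil Nil.

Lemma block_wf g : wf false g -> wf false (block g). Proof. by move=> /= ->. Qed.

Lemma marks_block g : marks 0 (block g) = 0 :: marks 1 g.
Proof. by rewrite /= cats0. Qed.

Definition of_size k n := [seq c <- forests k | sz c == n].

(** Prefixing a marked root costs one column and makes both lists of marks nonempty; forests with
    [a] and [b] marks then carry exactly a Delannoy number of staircases. *)
Lemma family_block k n : family n.+1
  (\sum_(p <- allpairs pair (of_size k n) (of_size k n)) delannoy n (nmarks p.1) (nmarks p.2)).
Proof.
pose pairs := allpairs pair (of_size k n) (of_size k n).
pose ext (p : code * code) := stairs 0 (marks 1 p.1) 0 (marks 1 p.2).
have [_ _ wfF] := levels_wf k; have [_ _ uF] := levels_uniq k.
have FP c : c \in of_size k n -> wf false (block c) /\ sz (block c) = n.+1.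
  by rewrite mem_filter => /andP[/eqP szc /wfF wc]; rewrite block_wf //= addn0 addn0 add0n szc.
pose s := [seq (p, E) | p <- pairs, E <- ext p].
have up : uniq pairs by apply: allpairs_uniq; rewrite ?filter_uniq // => -[? ?] [? ?].
have pu c : path ltn 0 (marks 1 c) by have := sorted_marks 0 (block c); rewrite marks_block.
have sP p E : (p, E) \in s -> [/\ p.1 \in of_size k n, p.2 \in of_size k n &
    stair 0 (marks 1 p.1) 0 (marks 1 p.2) E].
  case/allpairsPdep => p' [E' [/allpairsP[[c1 c2] /= [h1 h2 ->]] HE [-> ->]]].
  by split=> //; apply: stairs_stair.
have <- : size s = \sum_(p <- pairs) delannoy n (nmarks p.1) (nmarks p.2).
  rewrite /s size_allpairs_dep sumnE big_map big_seq [RHS]big_seq.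
  apply: eq_bigr => -[c1 c2] /allpairsP[[c1' c2'] /= [h1 h2 [-> ->]]].
  rewrite /ext /= (@size_stairs n) ?size_marks //.
  by move: h1; rewrite mem_filter => /andP[/eqP <- _]; apply: nmarks_sz.
apply: (@family_seq _ _ s (fun x => drawing (block x.1.1) (block x.1.2) x.2)).
- apply: allpairs_uniq_dep => //; first by move=> p _; apply: stairs_uniq.
  by move=> [p E] [p' E'] _ _ /= [-> ->].
- move=> [p E] /sP[/FP[w1 s1] /FP[w2 s2] st].
  by apply: drawing_valid st; rewrite ?marks_block.
- move=> [[c1 c2] E] [[c1' c2'] E'] /sP /= [/FP[w1 s1] /FP[w2 s2] st].
  move=> /sP /= [/FP[w1' s1'] /FP[w2' s2'] st'] H.
  have [] := @drawing_inj (block c1) (block c2) _ _ _ _ E (block c1') (block c2') _ _ _ _ E'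
     w1 w2 w1' w2' _ _ (marks_block c1) (marks_block c2) st
     (marks_block c1') (marks_block c2') st' H.
  + by rewrite s1 s1'.
  + by rewrite s2 s2'.
  + by move=> [->] [->] ->.
Qed.

(** * Generating functions *)

Import Order.TTheory GRing.Theory Num.Theory.
Import numFieldNormedType.Exports.
Local Open Scope ring_scope.

Lemma sum_allpairs (R : pzSemiRingType) (S T : Type) (s : seq S) (t : seq T)
    (F : S -> R) (G : T -> R) :
  \sum_(p <- allpairs pair s t) F p.1 * G p.2 = (\sum_(x <- s) F x) * (\sum_(x <- t) G x).
Proof. by rewrite big_allpairs_dep big_distrlr. Qed.

Section GeneratingFunction.
Variables (R : realType) (z y : R).
Hypotheses (z_gt0 : 0 < z) (y_gt0 : 0 < y).

Definition weight c : R := z ^+ sz c * y ^+ nmarks c.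
Definition gf (s : seq code) : R := \sum_(c <- s) weight c.

Lemma weight_ge0 c : 0 <= weight c.
Proof. by rewrite mulr_ge0 // exprn_ge0 // ltW. Qed.

Lemma gf_ge0 s : 0 <= gf s. Proof. by apply: sumr_ge0 => c _; apply: weight_ge0. Qed.

Lemma gf_cons c s : gf (c :: s) = weight c + gf s. Proof. exact: big_cons. Qed.

Lemma gf_cat s1 s2 : gf (s1 ++ s2) = gf s1 + gf s2. Proof. exact: big_cat. Qed.

Lemma weight_Nil : weight Nil = 1. Proof. by rewrite /weight !expr0 mulr1. Qed.

Lemma gf_Nil : gf [:: Nil] = 1. Proof. by rewrite /gf big_seq1 weight_Nil. Qed.

Lemma gf_nodes m L G Q T :
  gf (nodes m L G Q T) = z * y ^+ m * (gf L * gf G * gf Q * gf T).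
Proof.
rewrite /gf -!sum_allpairs /nodes big_map big_distrr /=.
by apply: eq_bigr => -[[[l g] r] t] _; rewrite /weight /= exprS !exprD; ring.
Qed.

Let a k := gf (wings k).
Let p k := gf (pwings k).
Let f k := gf (forests k).

Lemma gf_wingsS k : a k.+1 = 1 + z * a k ^+ 3 * f k.
Proof. by rewrite /a /f /= gf_cons weight_Nil gf_nodes; ring. Qed.

Lemma gf_pwingsS k : p k.+1 = z * y * a k ^+ 3 * f k + 3 * (z * a k ^+ 2 * f k * p k).
Proof. by rewrite /a /f /p /= !gf_cat !gf_nodes; ring. Qed.

Lemma gf_forestsS k : f k.+1 = 1 + (1 + y) * (z * f k * a k) + z * f k * p k.
Proof. by rewrite /a /f /p /= gf_cons !gf_cat weight_Nil !gf_nodes gf_Nil; ring. Qed.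

Let a_ge0 k : 0 <= a k. Proof. exact: gf_ge0. Qed.
Let p_ge0 k : 0 <= p k. Proof. exact: gf_ge0. Qed.
Let f_ge0 k : 0 <= f k. Proof. exact: gf_ge0. Qed.

Lemma gf_step k : [/\ a k <= a k.+1, p k <= p k.+1 & f k <= f k.+1].
Proof.
have z0 := ltW z_gt0; have y0 := ltW y_gt0.
elim: k => [|k [IHa IHp IHf]].
  rewrite gf_wingsS gf_pwingsS gf_forestsS /a /p /f /= gf_Nil /gf big_nil.
  by rewrite !expr1n !mulr1 !mulr0 !addr0 !lerDl !mulr_ge0 ?addr_ge0.
have P3 : a k ^+ 3 <= a k.+1 ^+ 3 by apply: lerXn2r; rewrite ?nnegrE.
have P2 : a k ^+ 2 <= a k.+1 ^+ 2 by apply: lerXn2r; rewrite ?nnegrE.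
have A3 j : 0 <= a j ^+ 3 by apply: exprn_ge0.
have A2 j : 0 <= a j ^+ 2 by apply: exprn_ge0.
split.
- by rewrite (gf_wingsS k.+1) {1}gf_wingsS lerD2l ler_pM ?mulr_ge0 ?ler_wpM2l //.
- rewrite (gf_pwingsS k.+1) {1}gf_pwingsS lerD //; first by rewrite ler_pM ?ler_wpM2l ?mulr_ge0 //.
  by rewrite ler_wpM2l // ler_pM ?mulr_ge0 // ler_pM ?mulr_ge0 // ler_wpM2l //.
- rewrite (gf_forestsS k.+1) {1}gf_forestsS lerD //; last by rewrite ler_pM ?mulr_ge0 ?ler_wpM2l //.
  by rewrite lerD2l ler_wpM2l ?addr_ge0 // ler_pM ?mulr_ge0 ?ler_wpM2l //.
Qed.

(** As [f k.+1] dominates both [z * a k] and [z * p k], a bound on forests also bounds the wings.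
    The three increasing sequences converge, and the recurrences pass to the limit. *)
Lemma gf_forests_limit M : (forall k, f k <= M) ->
  exists A P F : R, [/\ [/\ 1 <= A, 0 <= P & 1 <= F], A = 1 + z * A ^+ 3 * F,
    P = z * y * A ^+ 3 * F + 3 * (z * A ^+ 2 * F * P) &
    F = 1 + (1 + y) * (z * F * A) + z * F * P].
Proof.
move=> fM.
have a1 k : 1 <= a k.
  by case: k => [|k]; rewrite ?/a /= ?gf_Nil // -/(a k.+1);
    rewrite gf_wingsS lerDl !mulr_ge0 ?exprn_ge0 // ltW.
have f1 k : 1 <= f k.
  case: k => [|k]; first by rewrite /f /= gf_Nil.
  by rewrite gf_forestsS -addrA lerDl addr_ge0 ?mulr_ge0 ?addr_ge0 // ltW.
have aM k : a k <= M / z.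
  rewrite ler_pdivlMr // (le_trans _ (fM k.+1)) // gf_forestsS.
  have := f1 k; have := a1 k; have := p_ge0 k.
  have := mulr_ge0 (ltW z_gt0) (f_ge0 k) => zf pk ak fk.
  have zfp := mulr_ge0 zf pk.
  have zfa : z * a k <= z * f k * a k by rewrite -mulrA ler_wpM2l ?ler_peMl // ltW.
  have yzfa := mulr_ge0 (ltW y_gt0) (mulr_ge0 zf (a_ge0 k)).
  lra.
have pM k : p k <= M / z.
  rewrite ler_pdivlMr // (le_trans _ (fM k.+1)) // gf_forestsS.
  have := f1 k; have := a_ge0 k; have := p_ge0 k.
  have := mulr_ge0 (ltW z_gt0) (f_ge0 k) => zf pk ak fk.
  have zfp : z * p k <= z * f k * p k by rewrite -mulrA ler_wpM2l ?ler_peMl // ltW.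
  have zfa := mulr_ge0 zf ak.
  have yzfa := mulr_ge0 (ltW y_gt0) zfa.
  lra.
have cv (u : nat -> R) B : (forall k, u k <= u k.+1) -> (forall k, u k <= B) ->
    cvgn u /\ forall k, u k <= limn u.
  move=> /nondecreasing_seqP mono uB.
  have cu : cvgn u.
    by apply: nondecreasing_is_cvgn => //; exists B => _ [k _ <-].
  by split=> // k; apply: nondecreasing_cvgn_le.
have [ca la] := cv a _ (fun k => let: And3 h _ _ := gf_step k in h) aM.
have [cp lp] := cv p _ (fun k => let: And3 _ h _ := gf_step k in h) pM.
have [cf lf] := cv f _ (fun k => let: And3 _ _ h := gf_step k in h) fM.
exists (limn a), (limn p), (limn f).
have shift (u v : nat -> R) l : (forall k, u k.+1 = v k) -> cvgn u ->
    (v @ \oo --> l)%classic -> limn u = l.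
  move=> uv cu vl; apply: cvg_lim => //.
  rewrite -cvg_shiftS; rewrite (_ : [sequence u n.+1]_n = v) //.
  exact/funext.
split; first by split;
  [exact: le_trans (a1 0) _ | exact: le_trans (p_ge0 0) _ | exact: le_trans (f1 0) _].
- apply: (shift _ _ _ gf_wingsS ca).
  apply: cvgD; first exact: cvg_cst.
  apply: cvgM => //; apply: cvgM; first exact: cvg_cst.
  by apply: cvgM => //; apply: cvgM.
- apply: (shift _ _ _ gf_pwingsS cp).
  apply: cvgD; last first.
    apply: cvgM; first exact: cvg_cst.
    apply: cvgM => //; apply: cvgM => //; apply: cvgM; first exact: cvg_cst.
    exact: cvgM.
  apply: cvgM => //; apply: cvgM; first exact: cvg_cst.
  by apply: cvgM => //; apply: cvgM.
- apply: (shift _ _ _ gf_forestsS cf).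
  apply: cvgD; last by apply: cvgM => //; apply: cvgM => //; exact: cvg_cst.
  apply: cvgD; first exact: cvg_cst.
  apply: cvgM; first exact: cvg_cst.
  by apply: cvgM => //; apply: cvgM => //; exact: cvg_cst.
Qed.

End GeneratingFunction.

(* With [u = z A^2 F] the system for the limits reduces to
   1/z = 1/(u(1-u)^2) + (1+y)/(1-u) + y u/((1-u)(1-3u)), whose right-hand side
   exceeds 13.45 for y = 12/5. *)
Lemma gf_forests_unbounded (R : realType) (M : R) :
  exists k, M < gf (20 / 269) (12 / 5) (forests k).
Proof.
apply: contrapT => /forallNP H.
have z0 : 0 < 20 / 269 :> R by lra.
have y0 : 0 < 12 / 5 :> R by lra.
have [|A [P [F [[A1 P0 F1] EA EP EF]]]] := @gf_forests_limit R _ _ z0 y0 M.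
  by move=> k; rewrite leNgt; apply/negP/H.
pose u : R := 20 / 269 * A ^+ 2 * F.
have Agt0 : 0 < A by lra.
have Fgt0 : 0 < F by lra.
have u0 : 0 < u by rewrite /u; do 2!apply: mulr_gt0 => //; apply: exprn_gt0.
have EAu : A * (1 - u) = 1.
  have : A * (1 - u) = A - 20 / 269 * A ^+ 3 * F by rewrite /u; ring.
  by rewrite {2}EA => ->; ring.
have EPu : P * (1 - 3 * u) = 12 / 5 * u * A.
  have -> : P * (1 - 3 * u) = P - 3 * (20 / 269 * A ^+ 2 * F * P) by rewrite /u; ring.
  by rewrite {1}EP /u; ring.
have uAgt0 : 0 < 12 / 5 * u * A by do 2!apply: mulr_gt0 => //.
(* Since [P] is nonnegative, [EPu] forces [u < 1/3], the range where the final inequality holds. *)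
have u3 : 0 < 1 - 3 * u.
  rewrite ltNge; apply/negP => h.
  have : P * (1 - 3 * u) <= 0 by rewrite mulr_ge0_le0.
  by rewrite EPu leNgt uAgt0.
pose w : R := 20 / 269 * F.
have Ew : w = u * (1 - u) ^+ 2.
  have : w * (A * (1 - u)) ^+ 2 = u * (1 - u) ^+ 2 by rewrite /w /u; ring.
  by rewrite EAu expr1n mulr1.
have EFw : w * (269 / 20) = 1 + 17 / 5 * (w * A) + w * P.
  have -> : w * (269 / 20) = F by rewrite /w; field.
  by rewrite {1}EF /w; field.
have EwA : w * A = u * (1 - u).
  have -> : w * A = u * (1 - u) * (A * (1 - u)) by rewrite Ew; ring.
  by rewrite EAu mulr1.
have EwP : w * P * (1 - 3 * u) = 12 / 5 * u ^+ 2 * (1 - u).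
  have -> : w * P * (1 - 3 * u) = w * (P * (1 - 3 * u)) by ring.
  have -> : 12 / 5 * u ^+ 2 * (1 - u) = 12 / 5 * u * (w * A) by rewrite EwA; ring.
  by rewrite EPu; ring.
have key : (1 - 3 * u) + 17 / 5 * (u * (1 - u)) * (1 - 3 * u) + 12 / 5 * u ^+ 2 * (1 - u)
    = 269 / 20 * (u * (1 - u) ^+ 2) * (1 - 3 * u).
  rewrite -EwP -EwA -Ew.
  have -> : 269 / 20 * w = 1 + 17 / 5 * (w * A) + w * P by rewrite -EFw; ring.
  ring.
(* The value [19/100] is close to the minimizer of the rational function of [u] displayed above. The
   left side of [key] minus its right side is [(u - 19/100)^2] times this quadratic, plus a small
   remainder that is positive for [0 < u < 1/3]. *)
have Q : 0 <= 807 / 20 * u ^+ 2 - 71 * u + 276 / 10 by nra.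
have := mulr_ge0 (sqr_ge0 (u - 19 / 100)) Q.
nra.
Qed.

(** * From divergence to one large family *)

Definition level_weight (R : realType) k n : R := \sum_(c <- of_size k n) (12 / 5) ^+ nmarks c.

Lemma gf_forests_by_size (R : realType) (z : R) k : exists B,
  gf z (12 / 5) (forests k) = \sum_(n < B) z ^+ n * level_weight R k n.
Proof.
exists (\max_(c <- forests k) sz c).+1.
under [RHS]eq_bigr => n _ do rewrite /level_weight /of_size big_filter big_distrr big_mkcond /=.
rewrite exchange_big /= /gf big_seq [RHS]big_seq; apply: eq_bigr => c cF.
rewrite /weight -big_mkcond /=.
have cB : (sz c < (\max_(c <- forests k) sz c).+1)%N by rewrite ltnS leq_bigmax_seq.
rewrite (bigD1 (Ordinal cB)) //= big1 ?addr0 // => i /andP[/eqP E /eqP[]].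
exact/val_inj.
Qed.

Lemma sum_succ_geometric (R : realFieldType) (q : R) B : 0 <= q < 1 ->
  (1 - q) ^+ 2 * (\sum_(n < B) n.+1%:R * q ^+ n) <= 1.
Proof.
move=> /andP[q0 q1].
have -> : (1 - q) ^+ 2 * (\sum_(n < B) n.+1%:R * q ^+ n)
    = 1 - (B.+1%:R * q ^+ B - B%:R * q ^+ B.+1).
  elim: B => [|B IH]; first by rewrite big_ord0 mulr0 mul1r mul0r expr0; ring.
  rewrite big_ord_recr mulrDr IH /= !exprS -!natr1; ring.
rewrite lerBlDr lerDl subr_ge0 exprS mulrA; apply: ler_pM => //.
- by rewrite mulr_ge0.
- by rewrite exprn_ge0.
- by rewrite -natr1; have : 0 <= B%:R :> R by []; nra.
Qed.

(** Otherwise the series at [20/269] would be at most 14 times the sum of [(n+1) (268/269)^n], where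
    [268/269] is 13.40/13.45, hence at most [14 * 269^2]. *)
Lemma exists_heavy_level (R : realType) : exists k n,
  14 * n.+1%:R * (67 / 5) ^+ n <= level_weight R k n.
Proof.
apply: contrapT => /forallNP H.
have {}H k n : level_weight R k n <= 14 * n.+1%:R * (67 / 5) ^+ n.
  have /forallNP/(_ n)/negP := H k; rewrite -ltNge; exact: ltW.
have [k] := @gf_forests_unbounded R (14 * 269 ^+ 2).
apply/negP; rewrite -leNgt; have [B ->] := gf_forests_by_size (20 / 269 : R) k.
have qP : 0 <= (268 / 269 : R) < 1 by apply/andP; split; lra.
have S := @sum_succ_geometric _ _ B qP.
have q1 : 1 - 268 / 269 = 269^-1 :> R by lra.
rewrite q1 exprVn mulrC ler_pdivrMr ?mul1r ?exprn_gt0 ?ltr0n // in S.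
apply: (@le_trans _ _ (14 * \sum_(n < B) n.+1%:R * (268 / 269 : R) ^+ n));
  last exact: ler_wpM2l.
rewrite big_distrr /=; apply: ler_sum => n _.
apply: le_trans (ler_wpM2l _ (H k n)) _; first by apply: exprn_ge0; lra.
have -> : 268 / 269 = 20 / 269 * (67 / 5) :> R by lra.
have E (a b c : R) : a ^+ n * (14 * c * b ^+ n) = 14 * (c * (a * b) ^+ n).
  by rewrite exprMn; ring.
by rewrite E.
Qed.

Lemma sum_bin (R : pzSemiRingType) (x : R) m n : (m <= n)%N ->
  \sum_(j < n.+1) x ^+ j *+ 'C(m, j) = (x + 1) ^+ m.
Proof.
move=> mn; rewrite exprD1n (@big_ord_widen _ _ _ m.+1 n.+1 (fun i => x ^+ i *+ 'C(m, i))) //.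
rewrite [RHS]big_mkcond; apply: eq_bigr => j _.
by case: ltnP => // jm; rewrite bin_small.
Qed.

(** Cauchy-Schwarz against the constant sequence 1; the induction step is [(S - N x)^2 >= 0], which
    calls for [N > 0]. *)
Lemma sqr_sum_le (R : realDomainType) n (F : nat -> R) :
  (\sum_(j < n) F j) ^+ 2 <= n%:R * \sum_(j < n) F j ^+ 2.
Proof.
elim: n => [|n IH]; first by rewrite !big_ord0 expr0n mulr0.
rewrite !big_ord_recr /=.
case: n IH => [|n]; first by rewrite !big_ord0 => _; rewrite !add0r mul1r.
set S := \sum_(_ < _) _; set Q := \sum_(_ < _) _; set x := F n.+1 => IH.
set N : R := n.+1%:R in IH *.
have N0 : 0 < N by rewrite ltr0n.
rewrite -natr1 -/N -(ler_pM2l N0).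
have := sqr_ge0 (S - N * x); nra.
Qed.

(** Expanding [(1 + 7/5)^a] writes the level weight as a sum of [n + 1] terms [G j]. In the square
    of [G j] the factor [(7/5)^(2j)] is at most [2^j], and summing over [j] rebuilds the Delannoy
    numbers. *)
Lemma block_count_ge (R : realType) k n :
  level_weight R k n ^+ 2 <= n.+1%:R * (\sum_(p <- allpairs pair (of_size k n) (of_size k n))
    delannoy n (nmarks p.1) (nmarks p.2))%:R.
Proof.
have mn c : c \in of_size k n -> (nmarks c <= n)%N.
  by rewrite mem_filter => /andP[/eqP <- _]; apply: nmarks_sz.
pose G j : R := \sum_(c <- of_size k n) (7 / 5) ^+ j *+ 'C(nmarks c, j).
have -> : level_weight R k n = \sum_(j < n.+1) G j.
  rewrite exchange_big /level_weight big_seq [RHS]big_seq; apply: eq_bigr => c /mn cn.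
  rewrite sum_bin //; congr (_ ^+ _); lra.
apply: le_trans (sqr_sum_le _ _) _; rewrite ler_wpM2l //.
rewrite big_allpairs_dep /= /delannoy natr_sum.
under [leRHS]eq_bigr => c _ do rewrite natr_sum.
under [leRHS]eq_bigr => c _ do under eq_bigr => c' _ do rewrite natr_sum.
under [leRHS]eq_bigr => c _ do rewrite exchange_big.
rewrite exchange_big /=; apply: ler_sum => j _.
rewrite /G expr2 big_distrlr /=; apply: ler_sum => c _; apply: ler_sum => c' _.
rewrite -[X in X * _]mulr_natr -[X in _ * X]mulr_natr !natrM natrX.
rewrite mulrACA -exprMn mulrC ler_wpM2l ?mulr_ge0 //.
by apply: lerXn2r; rewrite ?nnegrE; lra.
Qed.

Lemma exists_family (R : realType) : exists m K,
  [/\ (0 < m)%N, family m K & (67 / 5) ^+ (2 * m) <= K%:R :> R].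
Proof.
have [k [n H]] := exists_heavy_level R.
exists n.+1; eexists; split=> //; first exact: (family_block k n).
have := block_count_ge R k n; set K : R := _%:R => HK.
have N1 : 1 <= n.+1%:R :> R by rewrite ler1n.
set N : R := n.+1%:R in N1 HK H.
rewrite mulnC exprM [X in X ^+ 2]exprSr.
set X : R := (67 / 5) ^+ n in H *.
have X1 : 1 <= X by apply: exprn_ege1; lra.
have : (14 * N * X) ^+ 2 <= level_weight R k n ^+ 2.
  by apply: lerXn2r; rewrite ?nnegrE //; [nra|apply: le_trans H; nra].
move=> /le_trans/(_ HK).
(* One factor [N] cancels the loss from Cauchy-Schwarz; [196] exceeds [(67/5)^2], the share of the
   additional column. *)
have -> : (14 * N * X) ^+ 2 = N * (196 * N * X ^+ 2) by ring.
rewrite ler_pM2l; last by lra.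
apply: le_trans; rewrite exprMn.
have X2 : 0 <= X ^+ 2 by apply: sqr_ge0.
nra.
Qed.

(** * Geometry of the double chain *)

Section Geometry.
Variable R : realType.
Implicit Types a b c d q x y : R * R.

Lemma orient_swap c d q : orient d c q = - orient c d q.
Proof. by rewrite /orient; ring. Qed.

Lemma orient_rot c d q : orient d q c = orient c d q.
Proof. by rewrite /orient; ring. Qed.

Lemma orient_ll c d : orient c d c = 0. Proof. by rewrite /orient; ring. Qed.
Lemma orient_lr c d : orient c d d = 0. Proof. by rewrite /orient; ring. Qed.

Lemma in_segment_sym a b q : in_segment a b q -> in_segment b a q.
Proof.
move=> [t [/andP[t0 t1] E1 E2]]; exists (1 - t); split; first by apply/andP; split; lra.
  by rewrite E1; ring.
by rewrite E2; ring.
Qed.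

(** [orient c d] is affine in its last argument, so it interpolates linearly along a segment. *)
Lemma in_segment_orient a b q c d : in_segment a b q -> exists t,
  [/\ 0 <= t <= 1, orient c d q = (1 - t) * orient c d a + t * orient c d b,
      t = 0 -> q = a & t = 1 -> q = b].
Proof.
case: a b q => [a1 a2] [b1 b2] [q1 q2] [t [tP /= -> ->]]; exists t; split=> //.
- by rewrite /orient /=; ring.
- by move=> ->; congr pair; ring.
- by move=> ->; congr pair; ring.
Qed.

Lemma segments_separated c d a b x y q : 0 <= orient c d a -> 0 <= orient c d b ->
  orient c d x < 0 -> orient c d y < 0 -> in_segment a b q -> in_segment x y q -> False.
Proof.
move=> ha hb hx hy /(in_segment_orient c d)[s [/andP[s0 s1] Es _ _]].
move=> /(in_segment_orient c d)[t [/andP[t0 t1] Et _ _]].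
have : 0 <= orient c d q by rewrite Es addr_ge0 // mulr_ge0 // subr_ge0.
apply/negP; rewrite -ltNge Et.
move: {Es Et} (orient c d x) (orient c d y) hx hy => u v u0 v0.
by case: (lerP u v) => uv; nra.
Qed.

Lemma segments_touch c d a b x y q : 0 <= orient c d a -> 0 <= orient c d b ->
  orient c d x = 0 -> orient c d y < 0 -> in_segment a b q -> in_segment x y q -> q = x.
Proof.
move=> ha hb hx hy /(in_segment_orient c d)[s [/andP[s0 s1] Es _ _]].
move=> /(in_segment_orient c d)[t [/andP[t0 t1] Et qx _]]; apply: qx.
have : 0 <= orient c d q by rewrite Es addr_ge0 // mulr_ge0 // subr_ge0.
rewrite Et hx mulr0 add0r nmulr_lge0 // => t0'.
by apply/eqP; rewrite eq_le t0' t0.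
Qed.

Lemma segments_share a b c q : orient a b c != 0 ->
  in_segment a b q -> in_segment a c q -> q = a.
Proof.
move=> h /(in_segment_orient a b)[s [/andP[s0 s1] Es _ _]].
move=> /(in_segment_orient a b)[t [/andP[t0 t1] Et qa _]]; apply: qa.
move: Es; rewrite Et orient_ll orient_lr !mulr0 addr0 add0r => /eqP.
by rewrite mulf_eq0 (negPf h) orbF => /eqP.
Qed.

(** Reflection in the horizontal axis makes the lower chain convex, so that the lemmas on the upper
    chain serve for both. *)
Definition flip q : R * R := (q.1, - q.2).

Lemma flipK : involutive flip. Proof. by case=> q1 q2; rewrite /flip opprK. Qed.

Lemma orient_flip c d q : orient (flip c) (flip d) (flip q) = - orient c d q.
Proof. by rewrite /orient /=; ring. Qed.

Lemma in_segment_flip a b q : in_segment a b q -> in_segment (flip a) (flip b) (flip q).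
Proof. by move=> [t [tP E1 E2]]; exists t; split=> //=; rewrite E2; ring. Qed.

Section Chain.
Variable n : nat.
Implicit Types (P U L : 'I_n -> R * R) (i j k l : 'I_n).

(** General position settles edges with a common endpoint. Otherwise the index intervals are
    disjoint or nested, and by convexity the line through one edge leaves the other strictly on one
    side. *)
Lemma chain_chain P i j k l q : convex_chain P ->
  (forall a b c : 'I_n, a != b -> b != c -> a != c -> orient (P a) (P b) (P c) != 0) ->
  (i < j)%N -> (k < l)%N -> (i, j) != (k, l) ->
  ~ (i < k < j /\ j < l)%N -> ~ (k < i < l /\ l < j)%N ->
  in_segment (P i) (P j) q -> in_segment (P k) (P l) q ->
  exists v, [/\ (v == i) || (v == j), (v == k) || (v == l) & q = P v].
Proof.
move=> [_ cP] share ij kl ne nc1 nc2 s1 s2.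
have pos (a b c : 'I_n) : (a < b)%N -> (b < c)%N ->
    [/\ 0 < orient (P a) (P b) (P c), 0 < orient (P b) (P c) (P a) &
        orient (P a) (P c) (P b) < 0].
  move=> ab bc; have h := cP _ _ _ ab bc; split=> //; first by rewrite orient_rot.
  by rewrite orient_swap (orient_rot (P b)) orient_rot oppr_lt0.
have ijN : i != j by rewrite -val_eqE /= ltn_eqF.
have klN : k != l by rewrite -val_eqE /= ltn_eqF.
have [ik|ik] := eqVneq i k.
  subst k; have jl : j != l by apply: contraNneq ne => ->.
  exists i; rewrite !eqxx; split=> //; exact: segments_share (share _ _ _ ijN jl klN) s1 s2.
have [il|il] := eqVneq i l.
  subst l; exists i; rewrite !eqxx orbT; split=> //.
  have jk : j != k by rewrite -val_eqE /=; lia.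
  by apply: segments_share (share _ _ _ ijN jk ik) s1 (in_segment_sym s2).
have [jk|jk] := eqVneq j k.
  subst k; exists j; rewrite !eqxx orbT; split=> //.
  by apply: segments_share (share _ _ _ _ il klN) (in_segment_sym s1) s2; rewrite eq_sym.
have [jl|jl] := eqVneq j l.
  subst l; exists j; rewrite !eqxx !orbT; split=> //.
  apply: segments_share (share _ _ _ _ ik _) (in_segment_sym s1) (in_segment_sym s2).
    by rewrite eq_sym.
  by [].
move: ik il jk jl; rewrite -!val_eqE /= => ik il jk jl; exfalso.
have [H|[H|[H|H]]] : ((j < k) \/ (l < i) \/ (i < k /\ l < j) \/ (k < i /\ j < l))%N by lia.
- have [h1 _ _] := pos _ _ _ ij H; have [h2 _ _] := pos _ _ _ ij (ltn_trans H kl).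
  apply: (segments_separated (c := P j) (d := P i) _ _ _ _ s1 s2);
    rewrite orient_swap ?orient_ll ?orient_lr ?oppr0 //; lra.
- have [h1 _ _] := pos _ _ _ kl H; have [h2 _ _] := pos _ _ _ kl (ltn_trans H ij).
  apply: (segments_separated (c := P l) (d := P k) _ _ _ _ s2 s1);
    rewrite orient_swap ?orient_ll ?orient_lr ?oppr0 //; lra.
- have [_ _ h1] := pos _ _ _ H.1 (ltn_trans kl H.2).
  have [_ _ h2] := pos _ _ _ (ltn_trans H.1 kl) H.2.
  by apply: (segments_separated (c := P i) (d := P j) _ _ _ _ s1 s2);
    rewrite ?orient_ll ?orient_lr.
- have [_ _ h1] := pos _ _ _ H.1 (ltn_trans ij H.2).
  have [_ _ h2] := pos _ _ _ (ltn_trans H.1 ij) H.2.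
  by apply: (segments_separated (c := P k) (d := P l) _ _ _ _ s2 s1); rewrite ?orient_ll ?orient_lr.
Qed.

(** If [k] lies outside the range from [i] to [j], consider the line through [U k] and the nearer
    end of the chain edge: a common point would have to be both of them. If [k] lies strictly
    inside, the whole cross edge is below the chord. *)
Lemma chain_cross U L i j k l q : convex_chain U -> injective U ->
  (forall i j k : 'I_n, (i < j)%N -> orient (U i) (U j) (L k) < 0) ->
  (i < j)%N -> in_segment (U i) (U j) q -> in_segment (U k) (L l) q ->
  ((k == i) || (k == j)) /\ q = U k.
Proof.
move=> [_ cU] injU below ij s1 s2.
have [kij|] := boolP ((k == i) || (k == j)).
  split=> //; have h := below i j l ij.
  apply: (segments_touch (c := U i) (d := U j) _ _ _ h s1 s2);
    rewrite ?orient_ll ?orient_lr //.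
  by case/orP: kij => /eqP ->; rewrite ?orient_ll ?orient_lr.
rewrite negb_or -!val_eqE /= => /andP[ki kj]; exfalso.
have disjoint (c d : 'I_n) : orient (U c) (U d) (U i) >= 0 -> orient (U c) (U d) (U j) >= 0 ->
    orient (U c) (U d) (U k) = 0 -> orient (U c) (U d) (L l) < 0 -> q = U k.
  by move=> h1 h2 h3 h4; apply: segments_touch h1 h2 h3 h4 s1 s2.
have swap_touch c d a b : orient c d (U k) <= 0 -> orient c d (L l) <= 0 ->
    orient c d a = 0 -> 0 < orient c d b -> in_segment a b q -> q = a.
  move=> h1 h2 h3 h4 s; apply: (segments_touch (c := d) (d := c) _ _ _ _ s2 s);
    rewrite orient_swap ?oppr_ge0 ?oppr_lt0 ?h3 ?oppr0 //.
have [ki'|ki'] := ltnP k i.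
  have h := below k i l ki'; have h' := cU _ _ _ ki' ij.
  have qk : q = U k by apply: disjoint h; rewrite ?orient_lr ?orient_ll // ltW.
  have qi : q = U i by apply: (swap_touch (U k) (U i)) h' s1; rewrite ?orient_ll ?orient_lr // ltW.
  by move: ki; rewrite -(injU _ _ (etrans (esym qk) qi)) eqxx.
have [jk'|jk'] := ltnP j k.
  have h := below j k l jk'; have h' := cU _ _ _ ij jk'; rewrite -orient_rot in h'.
  have qk : q = U k by apply: disjoint h; rewrite ?orient_lr ?orient_ll // ltW.
  have qj : q = U j.
    by apply: (swap_touch (U j) (U k)) h' (in_segment_sym s1); rewrite ?orient_ll ?orient_lr // ltW.
  by move: kj; rewrite -(injU _ _ (etrans (esym qk) qj)) eqxx.
have ik : (i < k)%N by lia.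
have kj' : (k < j)%N by lia.
have h := cU _ _ _ ik kj'; have h' := below i j l ij.
apply: (segments_separated (c := U i) (d := U j) _ _ _ h' s1 s2);
    rewrite ?orient_ll ?orient_lr //.
by rewrite orient_swap (orient_rot (U k)) orient_rot oppr_lt0.
Qed.

(** For [i < j] and [k < l], the line through [U i] and [L l] has [U j] and [L k] on opposite sides,
    so a common point would be both [U i] and [L l]. *)
Lemma cross_cross U L i j k l q : injective U ->
  (forall i k, U i != L k) ->
  (forall i k l, k != l -> orient (U i) (L k) (L l) != 0) ->
  (forall i j k, i != j -> orient (L k) (U i) (U j) != 0) ->
  (forall i j k : 'I_n, (i < j)%N -> orient (U i) (U j) (L k) < 0) ->
  (forall i j k : 'I_n, (i < j)%N -> 0 < orient (L i) (L j) (U k)) ->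
  (i <= j)%N -> (k <= l)%N -> (i, k) != (j, l) ->
  in_segment (U i) (L k) q -> in_segment (U j) (L l) q ->
  (i = j /\ q = U i) \/ (k = l /\ q = L k).
Proof.
move=> injU UL gpU gpL below above ij kl ne s1 s2.
have [E|ijN] := eqVneq i j.
  subst j; left; split=> //; apply: segments_share (gpU i k l _) s1 s2.
  by apply: contraNneq ne => ->.
have [E|klN] := eqVneq k l.
  subst l; right; split=> //.
  exact: segments_share (gpL i j k ijN) (in_segment_sym s1) (in_segment_sym s2).
exfalso; have {}ij : (i < j)%N by move: ijN; rewrite -val_eqE /=; lia.
have {}kl : (k < l)%N by move: klN; rewrite -val_eqE /=; lia.
have h1 : 0 < orient (U i) (L l) (U j).
  by rewrite orient_swap -orient_rot oppr_gt0 below.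
have h2 : orient (U i) (L l) (L k) < 0.
  by rewrite orient_swap orient_rot oppr_lt0 above.
have qi : q = U i.
  apply: (segments_touch (c := U i) (d := L l) _ _ _ h2 s2 s1);
    rewrite ?orient_ll ?orient_lr //; exact: ltW.
have ql : q = L l.
  apply: (segments_touch (c := L l) (d := U i) _ _ _ _ s1 (in_segment_sym s2));
    rewrite orient_swap ?orient_ll ?orient_lr ?oppr0 // ?oppr_ge0 ?oppr_lt0 //; exact: ltW.
by move: (UL i l); rewrite -qi -ql eqxx.
Qed.
End Chain.
End Geometry.

Arguments flip {R} q.

(** * From bridges to acyclic edge sets *)

Section EdgeSet.
Variable T : finType.
Implicit Types (e : rel T) (x y z w : T).

Definition edge_set e : {set {set T}} := [set [set p.1; p.2] | p : T * T & e p.1 p.2].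

Lemma set2_eq x y z w : [set x; y] = [set z; w] -> (x = z /\ y = w) \/ (x = w /\ y = z).
Proof.
move=> E; have /set2P[] : x \in [set z; w] by rewrite -E set21.
  move=> xz; subst z; have /set2P[yx|] : y \in [set x; w] by rewrite -E set22.
    by have : w \in [set x; y] by [rewrite E set22]; rewrite yx => /set2P[->|->]; left.
  by left.
move=> xw; subst w; have /set2P[|yx] : y \in [set z; x] by rewrite -E set22.
  by right.
by have : z \in [set x; y] by [rewrite E set21]; rewrite yx => /set2P[->|->]; right.
Qed.

Lemma edge_setP e x y : ([set x; y] \in edge_set e) = e x y || e y x.
Proof.
apply/imsetP/orP => [[[z w]]|[xy|yx]].
- by rewrite inE /= => zw /set2_eq[[-> ->]|[-> ->]]; [left|right].
- by exists (x, y); rewrite ?inE.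
- by exists (y, x); rewrite ?inE // finset.setUC.
Qed.

(** In a cycle of length at least three, the cut of the first edge is crossed by no other edge of
    the cycle, so walking from [y] the other way round to [x] never changes side. *)
Lemma bridged_acyclic e : irreflexive e -> bridged e -> acyclic (edge_set e).
Proof.
move=> irr br [|x [|y [|z s]]] // /andP[/= /and3P[xy yz zs]].
rewrite !inE !negb_or -!andbA => /and5P[xNy xNz xs yNz /andP[ys /andP[zNs _]]].
have [S [SD SU]] : exists S : pred T, S x != S y /\
    forall x' y', e x' y' -> S x' != S y' -> [set x'; y'] = [set x; y].
  move: xy; rewrite /adj edge_setP => /orP[/br|/br] [S [D U]]; exists S; split.
  - by [].
  - by move=> x' y' h h'; have [-> ->] := U _ _ h h'.
  - by rewrite eq_sym.
  - by move=> x' y' h h'; have [-> ->] := U _ _ h h'; rewrite finset.setUC.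
have same v w : adj (edge_set e) v w -> [set v; w] != [set x; y] -> S v = S w.
  rewrite /adj edge_setP => /orP[] h; apply: contraNeq => D.
    by rewrite (SU _ _ h D).
  by rewrite finset.setUC (SU _ _ h) // eq_sym.
have Syz : S y = S z.
  apply: same => //; apply/eqP => /set2_eq[[E _]|[_ E]].
    by rewrite E eqxx in xNy.
  by rewrite E eqxx in xNz.
have last_same : forall (p : seq T) v, path (adj (edge_set e)) v (rcons p x) ->
    v != x -> v != y -> x \notin p -> y \notin p -> S v = S x.
  elim=> [|u p IH] v /=.
    move=> /andP[vx _] vNx vNy _ _; apply: same => //.
    by apply/eqP => /set2_eq[[E _]|[E _]]; [rewrite E eqxx in vNx | rewrite E eqxx in vNy].
  move=> /andP[vu up] vNx vNy; rewrite !inE !negb_or => /andP[xNu xp] /andP[yNu yp].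
  rewrite -(IH u) // 1?eq_sym //; apply: same => //.
  by apply/eqP => /set2_eq[[E _]|[E _]]; [rewrite E eqxx in vNx | rewrite E eqxx in vNy].
by move: SD; rewrite Syz (last_same s z) ?eqxx // eq_sym.
Qed.

End EdgeSet.

(** * Drawings realized on a double chain *)

Section Realize.
Variables (R : realType) (n : nat) (U L : 'I_n -> R * R).
Hypothesis dc : double_chain U L.

Let T := ('I_n + 'I_n)%type.
Let p := chains_points U L.

Definition forget (v : T) : nat + nat :=
  match v with inl i => inl (val i) | inr i => inr (val i) end.

Lemma forget_inj : injective forget.
Proof. by move=> [i|i] [j|j] //= [] /val_inj ->. Qed.

Definition realize (g : rel (nat + nat)) : rel T := fun v w => g (forget v) (forget w).

Variable g : rel (nat + nat).
Hypothesis Vg : valid n g.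

Lemma realize_irr : irreflexive (realize g).
Proof. by case=> i; apply/negP; [move/(valid_up Vg) | move/(valid_low Vg)]; lia. Qed.

Lemma realize_bridged : bridged (realize g).
Proof.
move=> v w /(valid_bridged Vg)[S [D SU]]; exists (fun x => S (forget x)).
by split=> // x y xy /(SU _ _ xy)[/forget_inj -> /forget_inj ->].
Qed.

Lemma points_inj : injective p. Proof. by case: dc => -[]. Qed.

Lemma points_general x y z : x != y -> y != z -> x != z -> orient (p x) (p y) (p z) != 0.
Proof. by case: dc => -[_ +] _ _ _ _; apply. Qed.

Lemma flip_chain : convex_chain (flip \o L).
Proof.
case: dc => _ _ [inc cL] _ _; split=> [i j /inc //|i j k ij jk].
by rewrite orient_flip oppr_gt0 cL.
Qed.

Lemma flip_general (P : 'I_n -> R * R) (a b c : 'I_n) : 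
  orient (P a) (P b) (P c) != 0 -> orient (flip (P a)) (flip (P b)) (flip (P c)) != 0.
Proof. by rewrite orient_flip oppr_eq0. Qed.

Definition meet_at_vertex (x y z w : T) := forall q,
  in_segment (p x) (p y) q -> in_segment (p z) (p w) q ->
  exists2 v, v \in [set x; y] :&: [set z; w] & q = p v.

Lemma meet_swap x y z w : meet_at_vertex x y z w -> meet_at_vertex z w x y.
Proof. by move=> H q s1 s2; have [v vI ->] := H q s2 s1; exists v; rewrite // finset.setIC. Qed.

Lemma meet_rev x y z w : meet_at_vertex x y z w -> meet_at_vertex y x z w.
Proof.
move=> H q /in_segment_sym s1 s2; have [v vI ->] := H q s1 s2; exists v => //.
by rewrite (finset.setUC [set y]).
Qed.

Lemma meet_up i j k l : g (forget (inl i)) (forget (inl j)) ->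
  g (forget (inl k)) (forget (inl l)) ->
  (i, j) != (k, l) -> meet_at_vertex (inl i) (inl j) (inl k) (inl l).
Proof.
move=> /= ij kl ne q s1 s2.
have ij' := valid_up Vg ij; have kl' := valid_up Vg kl.
have cU : convex_chain U by case: dc.
have [|||||v [v1 v2 ->]] := chain_chain cU _ _ _ ne _ _ s1 s2.
- by move=> a b c ab bc ac; apply: (@points_general (inl a) (inl b) (inl c)).
- by lia.
- by lia.
- exact: (valid_up_planar Vg) ij kl.
- exact: (valid_up_planar Vg) kl ij.
by exists (inl v) => //; rewrite !inE; apply/andP.
Qed.

Lemma meet_low i j k l : g (forget (inr i)) (forget (inr j)) ->
  g (forget (inr k)) (forget (inr l)) ->
  (i, j) != (k, l) -> meet_at_vertex (inr i) (inr j) (inr k) (inr l).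
Proof.
move=> /= ij kl ne q /in_segment_flip s1 /in_segment_flip s2.
have ij' := valid_low Vg ij; have kl' := valid_low Vg kl.
have [|||||v [v1 v2]] := chain_chain flip_chain _ _ _ ne _ _ s1 s2.
- move=> a b c ab bc ac; apply: flip_general.
  exact: (@points_general (inr a) (inr b) (inr c)).
- by lia.
- by lia.
- exact: (valid_low_planar Vg) ij kl.
- exact: (valid_low_planar Vg) kl ij.
by move=> /(inv_inj (@flipK R)) ->; exists (inr v) => //; rewrite !inE; apply/andP.
Qed.

Lemma meet_up_low i j k l : g (forget (inl i)) (forget (inl j)) ->
  g (forget (inr k)) (forget (inr l)) ->
  meet_at_vertex (inl i) (inl j) (inr k) (inr l).
Proof.
move=> /= /(valid_up Vg) ij /(valid_low Vg) kl q s1 s2.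
have [_ _ _ below _] := dc.
have ij' : (i < j)%N by lia.
have h1 := below i j k ij'; have h2 := below i j l ij'; exfalso.
by apply: (segments_separated (c := U i) (d := U j) _ _ h1 h2 s1 s2);
    rewrite ?orient_ll ?orient_lr.
Qed.

Lemma meet_up_mid i j k l : g (forget (inl i)) (forget (inl j)) ->
  meet_at_vertex (inl i) (inl j) (inl k) (inr l).
Proof.
move=> /= /(valid_up Vg) ij q s1 s2; have [_ cU _ below _] := dc.
have ij' : (i < j)%N by lia.
have injU : injective U by move=> a b E; have [] := @points_inj (inl a) (inl b) E.
have [kij ->] := chain_cross cU injU below ij' s1 s2.
by exists (inl k); rewrite // !inE /= eqxx andbT.
Qed.

Lemma meet_low_mid i j k l : g (forget (inr i)) (forget (inr j)) ->
  meet_at_vertex (inr i) (inr j) (inl k) (inr l).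
Proof.
move=> /= /(valid_low Vg) ij q /in_segment_flip s1 /in_segment_sym/in_segment_flip s2.
have [_ _ _ _ above] := dc.
have ij' : (i < j)%N by lia.
have injL : injective (flip \o L).
  by move=> a b /(inv_inj (@flipK R)) E; have [] := @points_inj (inr a) (inr b) E.
have below (a b c : 'I_n) : (a < b)%N ->
    orient ((flip \o L) a) ((flip \o L) b) ((flip \o U) c) < 0.
  by move=> ab; rewrite orient_flip oppr_lt0 above.
have [lij E] := chain_cross flip_chain injL below ij' s1 s2.
by exists (inr l); [rewrite !inE eqxx orbT andbT | exact: (inv_inj (@flipK R) E)].
Qed.

Lemma meet_mid i j k l : g (forget (inl i)) (forget (inr k)) ->
  g (forget (inl j)) (forget (inr l)) ->
  (i <= j)%N -> (i, k) != (j, l) -> meet_at_vertex (inl i) (inr k) (inl j) (inr l).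
Proof.
move=> /= ik jl ij ne q; have [_ _ _ below above] := dc.
have injU : injective U by move=> a b E; have [] := @points_inj (inl a) (inl b) E.
have UL a b : U a != L b by apply/eqP => E; have := @points_inj (inl a) (inr b) E.
have gpU a b c : b != c -> orient (U a) (L b) (L c) != 0.
  by move=> bc; apply: (@points_general (inl a) (inr b) (inr c)).
have gpL a b c : a != b -> orient (L c) (U a) (U b) != 0.
  by move=> ab; apply: (@points_general (inr c) (inl a) (inl b)).
(* Monotonicity allows [l < k] only when [i = j], and then exchanging the two edges restores the
   order. *)
wlog kl : i j k l ik jl ij ne / (k <= l)%N.
  move=> W; have [|lk] := leqP k l; first exact: W.
  have [E|ijN] := eqVneq i j; last first.
    have ij' : (i < j)%N by move: ijN; rewrite -val_eqE /=; lia.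
    by have := valid_mono Vg ik jl ij'; lia.
  subst j; move=> s1 s2; have [||v vI ->] := W i i l k jl ik _ _ (ltnW lk) s2 s1 => //.
    by rewrite eq_sym.
  by exists v; rewrite // finset.setIC.
move=> s1 s2.
have [[E ->]|[E ->]] := cross_cross injU UL gpU gpL below above ij kl ne s1 s2; subst.
  by exists (inl j); rewrite // !inE !eqxx.
by exists (inr l); rewrite // !inE !eqxx !orbT.
Qed.

Lemma meet_edges x y z w : realize g x y -> realize g z w -> (x, y) != (z, w) ->
  meet_at_vertex x y z w.
Proof.
case: x y z w => [i|i] [j|j] [k|k] [l|l]; rewrite /realize => E1 E2 ne;
  try (by rewrite /= (valid_dir Vg) in E1); try (by rewrite /= (valid_dir Vg) in E2).
- by apply: meet_up => //; apply: contraNneq ne => -[-> ->].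
- exact: meet_up_mid.
- exact: meet_up_low.
- exact/meet_swap/meet_up_mid.
- have [ik|/ltnW ik] := leqP i k.
    by apply: meet_mid => //; apply: contraNneq ne => -[-> ->].
  by apply/meet_swap/meet_mid => //; apply: contraNneq ne => -[-> ->].
- exact/meet_swap/meet_low_mid.
- exact/meet_swap/meet_up_low.
- exact: meet_low_mid.
- by apply: meet_low => //; apply: contraNneq ne => -[-> ->].
Qed.

Lemma realize_forest : noncrossing_forest p (edge_set (realize g)).
Proof.
split.
- move=> _ /imsetP[[x y] /[!inE] /= xy ->]; rewrite cards2; case: eqP => // E.
  by move: xy; rewrite E realize_irr.
- exact: bridged_acyclic realize_irr realize_bridged.
- move=> x y z w; rewrite !edge_setP => E1 E2 ne q.
  suff : meet_at_vertex x y z w by apply.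
  have ne1 : (x, y) != (z, w) by apply: contraNneq ne => -[-> ->].
  have ne2 : (x, y) != (w, z) by apply: contraNneq ne => -[-> ->]; rewrite finset.setUC.
  have ne3 : (y, x) != (z, w) by apply: contraNneq ne => -[-> ->]; rewrite finset.setUC.
  have ne4 : (y, x) != (w, z) by apply: contraNneq ne => -[-> ->].
  case/orP: E1 => E1; case/orP: E2 => E2.
  + exact: meet_edges.
  + exact/meet_swap/meet_rev/meet_swap/meet_edges.
  + exact/meet_rev/meet_edges.
  + exact/meet_rev/meet_swap/meet_rev/meet_swap/meet_edges.
Qed.

End Realize.

(** Edge sets forget directions, but validity restores them: from smaller to larger index inside a
    chain, from upper to lower chain otherwise. *)
Lemma realize_inj n (g h : rel (nat + nat)) : valid n g -> valid n h ->
  edge_set (@realize n g) = edge_set (@realize n h) -> g =2 h.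
Proof.
have sub g1 h1 : valid n g1 -> valid n h1 ->
    edge_set (@realize n g1) = edge_set (@realize n h1) -> forall v w, g1 v w -> h1 v w.
  move=> Vg Vh E v w vw; have [vn wn] := valid_index Vg vw.
  have lift x : (vertex_index x < n)%N -> exists x' : 'I_n + 'I_n, x = forget x'.
    by case: x => i /= i_n; [exists (inl (Ordinal i_n)) | exists (inr (Ordinal i_n))].
  have [v' Ev] := lift v vn; have [w' Ew] := lift w wn; subst v w.
  have : [set v'; w'] \in edge_set (@realize n h1) by rewrite -E edge_setP /realize vw.
  rewrite edge_setP /realize => /orP[//|wv]; exfalso; move: vw wv.
  case: v' w' {vn wn} => [i|i] [j|j] /=.
  - by move=> /(valid_up Vg) + /(valid_up Vh); lia.
  - by rewrite (valid_dir Vh).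
  - by rewrite (valid_dir Vg).
  - by move=> /(valid_low Vg) + /(valid_low Vh); lia.
move=> Vg Vh E v w; apply/idP/idP; [exact: sub|]; exact: sub.
Qed.

Lemma family_forests (R : realType) n K (U L : 'I_n -> R * R) : double_chain U L ->
  family n K -> (K <= num_noncrossing_forests (chains_points U L))%N.
Proof.
move=> dc [I [g [<- Vg gI]]].
have inj : injective (fun i => edge_set (@realize n (g i))).
  by move=> i j /(realize_inj (Vg i) (Vg j)) /gI.
rewrite -(card_imset _ inj); apply: subset_leq_card; apply/fintype.subsetP => _ /imsetP[i _ ->].
by rewrite inE; apply/asboolP; apply: realize_forest.
Qed.

Theorem theorem2 (R : realType) :
  exists2 c : R, 0 < c &
  exists n0 : nat, forall n : nat, (n0 <= n)%N ->
  forall U L : 'I_n -> R * R, double_chain U L ->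
    c * (1340 / 100) ^+ (2 * n) <=
    (num_noncrossing_forests (chains_points U L))%:R.
Proof.
have [m [K [m0 Km HK]]] := exists_family R.
have -> : 1340 / 100 = 67 / 5 :> R by lra.
set X : R := 67 / 5 in HK *.
have X0 : 0 < X by rewrite /X; lra.
have X1 : 1 <= X by rewrite /X; lra.
(* The constant pays for the fewer than [m] columns left empty after [n %/ m] blocks. *)
exists (X ^- (2 * m)); first by rewrite invr_gt0 exprn_gt0.
exists 0%N => n _ U L dc.
have F : family n (K ^ (n %/ m)) by rewrite {1}(divn_eq n m) mulnC; apply: family_exp.
apply: le_trans (_ : (K ^ (n %/ m))%:R <= _); last first.
  by rewrite ler_nat; apply: family_forests dc F.
rewrite natrX mulrC ler_pdivrMr ?exprn_gt0 //.
apply: (@le_trans _ _ ((X ^+ (2 * m)) ^+ (n %/ m) * X ^+ (2 * m))).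
  rewrite -exprM -exprD ler_weXn2l //.
  have := ltn_pmod n m0; have := divn_eq n m; nia.
rewrite ler_pM2r ?exprn_gt0 //.
by apply: lerXn2r; rewrite ?nnegrE ?exprn_ge0 // ltW.
Qed.
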